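(* Let $R$ be a proof-structure of $\mathsf{MELL}_{pol}$. The following are equivalent: (1) $R\models\mathsf{ACC}_{\sharp\mathsf w}$; (2) $R\models\mathsf{ACC}_{\mathsf i/\mathsf o}$; (3) $R$ is sequentializable (in $\mathsf{MELL}_{pol}$).
   Context: Graphs. A graph $G$ consists of finite disjoint sets $N(G)$ (nodes), $A(G)$ (arcs) and functions $\mathrm{tail},\mathrm{head}:A(G)\to N(G)$ (loops and parallel arcs allowed). An arc $a$ is a conclusion of $\mathrm{tail}(a)$ and a premise of $\mathrm{head}(a)$; its ends are $\mathrm{tail}(a),\mathrm{head}(a)$. A path from $n_0$ to $n_k$ is an alternating sequence $n_0a_1n_1\dots a_kn_k$ ($k\ge 0$) of nodes and arcs such that the ends of $a_i$ are $n_{i-1}$ and $n_i$; $n_i=n_j$ with $i\ne j$ implies $\{i,j\}=\{0,k\}$; and $a_1\neq a_k$ if $k\ge2$. It is directed if $\mathrm{tail}(a_i)=n_{i-1}$ and $\mathrm{head}(a_i)=n_i$ for all $i$; it is a cycle if $k>0$ and $n_0=n_k$. $G$ is (directed) acyclic if it has no (directed) cycle. $\mathrm{cc}(G)$ is the set of (non-empty) connected components of $G$; $\sharp S$ is the cardinality of $S$. Ground-structures. Write $\wp$ for par. A ground-structure is a graph whose nodes carry labels in $\{\mathtt{ax},\mathtt{cut},\mathtt 1,\bot,\otimes,\wp,!,?\mathtt d,?,\bullet\}$ with the following numbers of premises and conclusions: $\mathtt{ax}$: 0 premises, 2 conclusions; $\mathtt{cut}$: 2, 0; $\mathtt 1$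 and $\bot$: 0, 1; $\otimes$ and $\wp$: 2, 1; $!$: 0 premises, at least 1 conclusion; $?\mathtt d$: 1, 1; $?$: any number $k\ge0$ of premises, 1 conclusion; $\bullet$: 1, 0. It is equipped with a total order on the set of premises of its $\bullet$ nodes (these arcs are the conclusions of the ground-structure), on the conclusions of each $!$ node, and on the premises of each $\otimes$ and $\wp$ node (left, right). The greatest conclusion of a $!$ node is its principal port, the others its auxiliary ports. A $?$ node with $0$ premises is a $?\mathtt w$ node; with at least $2$ premises a $?\mathtt c$ node. $\mathsf w(\mathcal G)$ is the set of $\bot$ and $?\mathtt w$ nodes of $\mathcal G$. Proof-structures. A proof-structure (of finite depth, inductively) is a pair $R=(\mathcal G_R,\mathrm{box}_R)$ where $\mathcal G_R$ is a ground-structure and $\mathrm{box}_R$ maps each $!$ node $n$ of $\mathcal G_R$ to a proof-structure $\mathrm{box}_R(n)$ (its box) whose ground-structure has as many conclusions as $n$, all the sets of nodes and arcs involved being pairwise disjoint. Write $R'\sqsubset R$ if $R'=\mathrm{box}_R(n)$ for some $!$ node $n$ of $\mathcal G_R$. Proof-structures are considered up to renaming of nodes and arcs. Formulae. Atomic formulae form a countably infinite set with a fixed-point-free involution $X\mapsto X^\bot$, and are split into two disjoint classes exchanged by it. $\mathsf{MELL}$ formulae: $A::=X\mid\mathbf 1\mid\bot\mid A\otimes A\mid A\wp A\mid {!A}\mid{?A}$, with linear negation the involution given by $\mathbf 1^\bot=\bot$, $(A\otimes B)^\bot=A^\bot\wp B^\bot$, $(!A)^\bot={?A^\bot}$. The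 fragment $\mathsf{MELL}_{pol}$ consists of the negative formulae $N::=X\mid\bot\mid N\wp N\mid{?P}$ and the positive formulae $P::=X^\bot\mid\mathbf 1\mid P\otimes P\mid{!N}$ ($X$ ranging over one class of atoms, $X^\bot$ over the other). Sequent calculus (one-sided sequents = finite sequences of formulae of the fragment): $\vdash A,A^\bot$ (ax); from $\vdash\Gamma,A$ and $\vdash A^\bot,\Delta$ infer $\vdash\Gamma,\Delta$ (cut); $\vdash\mathbf 1$; from $\vdash\Gamma$ infer $\vdash\Gamma,\bot$; from $\vdash\Gamma,A$ and $\vdash B,\Delta$ infer $\vdash\Gamma,A\otimes B,\Delta$; from $\vdash\Gamma,A,B$ infer $\vdash\Gamma,A\wp B$; from $\vdash{?\Gamma},A$ infer $\vdash{?\Gamma},{!A}$; from $\vdash\Gamma,A$ infer $\vdash\Gamma,{?A}$ (dereliction); from $\vdash\Gamma,{?A},\dots,{?A}$ ($k\ge0$ copies) infer $\vdash\Gamma,{?A}$; exchange. Typed proof-structures. A proof-structure of a fragment $\mathcal F$ is a proof-structure whose arcs are labelled by formulae of $\mathcal F$ (types) so that: $\mathtt{ax}$ conclusions have types $A,A^\bot$; $\mathtt{cut}$ premises have types $A,A^\bot$; $\mathtt 1$, $\bot$ conclusions have types $\mathbf 1$, $\bot$; $\otimes$ (resp. $\wp$) with left, right premises $A,B$ has conclusion $A\otimes B$ (resp. $A\wp B$); $?\mathtt d$ with premise $A$ has conclusion ${?A}$; a $?$ node has all premises and its conclusion of a same type ${?A}$; a $!$ node has (ordered) conclusions of types ${?A_1},\dots,{?A_k},{!A}$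 and its box is a proof-structure of $\mathcal F$ with (ordered) conclusions of types ${?A_1},\dots,{?A_k},A$. Desequentialization: each sequent calculus proof $\pi$ in $\mathcal F$ of $\vdash A_1,\dots,A_k$ yields a proof-structure $\pi^*$ of $\mathcal F$ with ordered conclusions of types $A_1,\dots,A_k$: ax and $\mathbf 1$ rules give a single $\mathtt{ax}$, $\mathtt 1$ node; cut and $\otimes$ rules give the disjoint union of $\pi_1^*,\pi_2^*$ plus a $\mathtt{cut}$, $\otimes$ node having as premises the conclusions corresponding to the active formulae; $\bot,\wp$, dereliction and $?$ rules add to $\pi_1^*$ a node $\bot,\wp,?\mathtt d,?$ with premises the conclusions corresponding to the active formulae; a $!$ rule gives a single $!$ node with box $\pi_1^*$; exchange permutes the order of conclusions. $R$ is sequentializable if $R=\pi^*$ for some sequent calculus proof $\pi$ in $\mathcal F$. The property $\mathsf{ACC}_{\sharp\mathsf w}$. A switching $\varphi$ of $\mathcal G$ maps each $\wp$ or $?\mathtt c$ node $n$ to one of its premises; $\mathcal G^\varphi$ is the graph obtained by erasing, for each such $n$, every premise of $n$ except $\varphi(n)$. $\mathcal G\models\mathsf{ACC}_{\sharp\mathsf w}$ if for every switching $\varphi$ the graph $\mathcal G^\varphi$ is acyclic and $\sharp\mathrm{cc}(\mathcal G^\varphi)=\sharp\mathsf w(\mathcal G)+1$. The property $\mathsf{ACC}_{\mathsf i/\mathsf o}$. In a proof-structure of $\mathsf{MELL}_{pol}$ call an arc output ($\mathsf o$) if its type is positive, input ($\mathsf i$) if its type is negative. A $\wp_{\mathsf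 o}$ node is a $\wp$ node with output conclusion (none exists in $\mathsf{MELL}_{pol}$). $\mathsf d_{\mathsf c}(\mathcal G)$ is the set of $?\mathtt d$ nodes with output premise, $\mathsf o(\mathcal G)$ the set of $\bullet$ nodes with output premise. $\mathcal G^{\mathsf i/\mathsf o}$ is obtained from $\mathcal G$ by erasing the input premise of every $\wp_{\mathsf o}$ node and reversing every input arc. $\mathcal G\models\mathsf{ACC}_{\mathsf i/\mathsf o}$ if $\mathcal G^{\mathsf i/\mathsf o}$ is directed acyclic and $\sharp\mathsf d_{\mathsf c}(\mathcal G)+\sharp\mathsf o(\mathcal G)=1$. $R$ satisfies $\mathsf{ACC}_{\sharp\mathsf w}$ (resp. $\mathsf{ACC}_{\mathsf i/\mathsf o}$) if $\mathcal G_R$ does and, inductively, every $R'\sqsubset R$ does. *)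

(* Defs.v *)
From HB Require Import structures.
From mathcomp Require Import all_boot.

Set Implicit Arguments.
Unset Strict Implicit.
Unset Printing Implicit Defensive.

Record graph := Graph {
  nodes : finType;
  arcs : finType;
  tail : arcs -> nodes;
  head : arcs -> nodes }.

Section GraphTheory.
Variable G : graph.

Definition premises (n : nodes G) : {set arcs G} := [set a | head a == n].
Definition conclusions (n : nodes G) : {set arcs G} := [set a | tail a == n].

Definition dlink (a : arcs G) (x y : nodes G) : bool :=
  (tail a == x) && (head a == y).
Definition ulink (a : arcs G) (x y : nodes G) : bool :=
  dlink a x y || dlink a y x.

Fixpoint walk (link : arcs G -> rel (nodes G)) (x : nodes G)
    (p : seq (arcs G * nodes G)) : bool :=
  if p is (a, y) :: p' then link a x y && walk link y p' else true.

(* The sequence n_0 a_1 n_1 ... a_k n_k is given by n_0 and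
   p = [:: (a_1, n_1); ...; (a_k, n_k)]. *)
Definition is_path (link : arcs G -> rel (nodes G)) (n0 : nodes G)
    (p : seq (arcs G * nodes G)) : Prop :=
  let k := size p in
  let node_at := nth n0 (n0 :: unzip2 p) in
  [/\ walk link n0 p,
      forall i j, i <= k -> j <= k -> i <> j -> node_at i = node_at j ->
        (i = 0 /\ j = k) \/ (i = k /\ j = 0)
    & forall a b, 2 <= k -> ohead (unzip1 p) = Some a ->
        ohead (rev (unzip1 p)) = Some b -> a <> b].

Definition is_cycle (link : arcs G -> rel (nodes G)) (n0 : nodes G)
    (p : seq (arcs G * nodes G)) : Prop :=
  [/\ is_path link n0 p, 0 < size p & last n0 (unzip2 p) = n0].

Definition acyclic : Prop := forall n0 p, ~ is_cycle ulink n0 p.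
Definition directed_acyclic : Prop := forall n0 p, ~ is_cycle dlink n0 p.

Definition adjacent : rel (nodes G) := fun x y => [exists a, ulink a x y].

Definition cc : {set {set nodes G}} :=
  [set [set m | connect adjacent n m] | n : nodes G].

Definition keep_arcs (keep : pred (arcs G)) : graph :=
  @Graph (nodes G) {a : arcs G | keep a}
    (fun a => tail (val a)) (fun a => head (val a)).

Definition reverse_arcs (rv : pred (arcs G)) : graph :=
  @Graph (nodes G) (arcs G)
    (fun a => if rv a then head a else tail a)
    (fun a => if rv a then tail a else head a).

End GraphTheory.

Variant label :=
  Lax | Lcut | Lone | Lbot | Ltens | Lpar | Lbang | Lder | Lwhy | Lconc.

Definition label_eq_dec : comparable label.
Proof. by move=> x y; rewrite /decidable; decide equality. Defined.
HB.instance Definition _ := hasDecEq.Build label (compareP label_eq_dec).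

Definition is_bang (l : label) : bool := if l is Lbang then true else false.

(* Total orders on finite sets of arcs are given by the increasing enumeration
   of these sets: [concls] for the conclusions of the ground-structure,
   [bang_concls n] for the conclusions of a ! node n (its principal port comes
   last), [prems n] for the left and right premises of a tensor or par node n.
   The values of [bang_concls] and [prems] on other nodes are irrelevant. *)
Record ground := Ground {
  gr :> graph;
  lab : nodes gr -> label;
  concls : seq (arcs gr);
  bang_concls : nodes gr -> seq (arcs gr);
  prems : nodes gr -> seq (arcs gr) }.

(* [arity l p c]: a node labelled by l may have p premises and c conclusions. *)
Definition arity (l : label) (p c : nat) : bool :=
  match l with
  | Lax => (p == 0) && (c == 2)
  | Lcut => (p == 2) && (c == 0)
  | Lone | Lbot => (p == 0) && (c == 1)
  | Ltens | Lpar => (p == 2) && (c == 1)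
  | Lbang => (p == 0) && (1 <= c)
  | Lder => (p == 1) && (c == 1)
  | Lwhy => c == 1
  | Lconc => (p == 1) && (c == 0)
  end.

Definition enumerates (T : finType) (s : seq T) (A : {set T}) : Prop :=
  uniq s /\ s =i A.

Definition is_ground_structure (G : ground) : Prop :=
  [/\ forall n : nodes G, arity (lab n) #|premises n| #|conclusions n|,
      enumerates (concls G) [set a | lab (head a) == Lconc],
      forall n : nodes G, lab n = Lbang ->
        enumerates (bang_concls n) (conclusions n)
    & forall n : nodes G, lab n \in [:: Ltens; Lpar] ->
        enumerates (prems n) (premises n)].

Definition is_contraction (G : ground) (n : nodes G) : bool :=
  (lab n == Lwhy) && (2 <= #|premises n|).
Definition is_weakening (G : ground) (n : nodes G) : bool :=
  (lab n == Lwhy) && (#|premises n| == 0).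

(* The atoms are [Var n] (negative) and [NVar n] (positive). *)
Inductive formula :=
  | Var of nat
  | NVar of nat
  | One
  | Bot
  | Tens of formula & formula
  | Par of formula & formula
  | OfCourse of formula
  | WhyNot of formula.

Fixpoint dual (A : formula) : formula :=
  match A with
  | Var n => NVar n
  | NVar n => Var n
  | One => Bot
  | Bot => One
  | Tens A B => Par (dual A) (dual B)
  | Par A B => Tens (dual A) (dual B)
  | OfCourse A => WhyNot (dual A)
  | WhyNot A => OfCourse (dual A)
  end.

Fixpoint negative (A : formula) : bool :=
  match A with
  | Var _ | Bot => true
  | Par A B => negative A && negative B
  | WhyNot A => positive A
  | _ => false
  end
with positive (A : formula) : bool :=
  match A with
  | NVar _ | One => true
  | Tens A B => positive A && positive B
  | OfCourse A => negative A
  | _ => false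
  end.

Definition fragment := pred formula.
Definition MELLpol : fragment := fun A => negative A || positive A.

(* Trees of ground-structures with arcs labelled by formulae; the conditions
   making them typed proof-structures are stated below.  Distinct boxes have
   distinct node and arc types, hence are disjoint. *)
Inductive proof_structure := PS (G : ground) (ty : arcs G -> formula)
  (box : forall n : nodes G, is_bang (lab n) -> proof_structure).

Definition ground_of (R : proof_structure) : ground := let: PS G _ _ := R in G.
Definition type_of (R : proof_structure) : arcs (ground_of R) -> formula :=
  let: PS _ ty _ := R in ty.
Definition box_of (R : proof_structure) :
    forall n : nodes (ground_of R), is_bang (lab n) -> proof_structure :=
  let: PS _ _ box := R in box.

Definition concls_of (R : proof_structure) : seq (arcs (ground_of R)) :=
  concls (ground_of R).
Definition concl_types (R : proof_structure) : seq formula :=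
  [seq type_of a | a <- concls_of R].

Fixpoint is_proof_structure (R : proof_structure) : Prop :=
  let: PS G _ box := R in
  is_ground_structure G /\
  forall (n : nodes G) (h : is_bang (lab n)),
    size (concls_of (box n h)) = #|conclusions n| /\
    is_proof_structure (box n h).

Definition node_typed (G : ground) (ty : arcs G -> formula) (n : nodes G) :
    Prop :=
  match lab n with
  | Lax => forall a b, tail a = n -> tail b = n -> a <> b -> ty b = dual (ty a)
  | Lcut => forall a b, head a = n -> head b = n -> a <> b -> ty b = dual (ty a)
  | Lone => forall c, tail c = n -> ty c = One
  | Lbot => forall c, tail c = n -> ty c = Bot
  | Ltens => forall c, tail c = n -> exists A B,
      [seq ty a | a <- prems n] = [:: A; B] /\ ty c = Tens A B
  | Lpar => forall c, tail c = n -> exists A B,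
      [seq ty a | a <- prems n] = [:: A; B] /\ ty c = Par A B
  | Lder => forall a c, head a = n -> tail c = n -> ty c = WhyNot (ty a)
  | Lwhy => exists A, forall a, head a = n \/ tail a = n -> ty a = WhyNot A
  | Lbang | Lconc => True
  end.

Fixpoint typed_in (F : fragment) (R : proof_structure) : Prop :=
  let: PS G ty box := R in
  [/\ forall a, F (ty a),
      forall n, node_typed ty n
    & forall (n : nodes G) (h : is_bang (lab n)),
        (exists As A,
           [seq ty a | a <- bang_concls n]
             = map WhyNot As ++ [:: OfCourse A] /\
           concl_types (box n h) = map WhyNot As ++ [:: A]) /\
        typed_in F (box n h)].

Definition proof_structure_of (F : fragment) (R : proof_structure) : Prop :=
  is_proof_structure R /\ typed_in F R.

(* Proof-structures are considered up to renaming of nodes and arcs. *)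
Definition ground_renaming (G G' : ground) (f : nodes G -> nodes G')
    (g : arcs G -> arcs G') : Prop :=
  [/\ bijective f /\ bijective g,
      (forall a, tail (g a) = f (tail a)) /\ (forall a, head (g a) = f (head a)),
      forall n, lab (f n) = lab n,
      concls G' = map g (concls G)
    & (forall n, lab n = Lbang -> bang_concls (f n) = map g (bang_concls n)) /\
      (forall n, lab n \in [:: Ltens; Lpar] ->
         prems (f n) = map g (prems n))].

Fixpoint ps_equal (R R' : proof_structure) {struct R} : Prop :=
  match R, R' with
  | PS G ty box, PS G' ty' box' =>
    exists (f : nodes G -> nodes G') (g : arcs G -> arcs G'),
    [/\ ground_renaming f g,
        forall a, ty' (g a) = ty a
      & forall n (h : is_bang (lab n)) (h' : is_bang (lab (f n))),
          ps_equal (box n h) (box' (f n) h')]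
  end.

(* [permute s sigma] lists the items of s in the order given by the list
   sigma of their positions. *)
Definition permute (T : Type) (s : seq T) (sigma : seq nat) : seq T :=
  pmap (onth s) sigma.

Inductive proof : seq formula -> Type :=
  | p_ax A : proof [:: A; dual A]
  | p_cut Gamma Delta A of
      proof (Gamma ++ [:: A]) & proof (dual A :: Delta) :
      proof (Gamma ++ Delta)
  | p_one : proof [:: One]
  | p_bot Gamma of proof Gamma : proof (Gamma ++ [:: Bot])
  | p_tens Gamma Delta A B of
      proof (Gamma ++ [:: A]) & proof (B :: Delta) :
      proof (Gamma ++ Tens A B :: Delta)
  | p_par Gamma A B of proof (Gamma ++ [:: A; B]) :
      proof (Gamma ++ [:: Par A B])
  | p_bang Gamma A of proof (map WhyNot Gamma ++ [:: A]) :
      proof (map WhyNot Gamma ++ [:: OfCourse A])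
  | p_der Gamma A of proof (Gamma ++ [:: A]) : proof (Gamma ++ [:: WhyNot A])
  | p_why Gamma A k of proof (Gamma ++ nseq k (WhyNot A)) :
      proof (Gamma ++ [:: WhyNot A])
  | p_exch Gamma sigma of perm_eq sigma (iota 0 (size Gamma)) & proof Gamma :
      proof (permute Gamma sigma).

(* All the sequents of the proof consist of formulae of the fragment. *)
Fixpoint proof_in (F : fragment) (Gamma : seq formula) (pi : proof Gamma) :
    bool :=
  all F Gamma &&
  match pi with
  | p_ax _ | p_one => true
  | p_cut _ _ _ pi1 pi2 | p_tens _ _ _ _ pi1 pi2 =>
      proof_in F pi1 && proof_in F pi2
  | p_bot _ pi1 | p_par _ _ _ pi1 | p_bang _ _ pi1 | p_der _ _ pi1
  | p_why _ _ _ pi1 | p_exch _ _ _ pi1 => proof_in F pi1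
  end.

Definition nobox (h : false) : proof_structure := match notF h with end.

Definition ps_empty : proof_structure :=
  @PS (@Ground (@Graph void void id id)
         (fun n => match n with end) [::] (fun=> [::]) (fun=> [::]))
    (fun a => match a with end) (fun n => match n with end).

Section DisjointUnion.
Variables R1 R2 : proof_structure.
Let G1 := ground_of R1.
Let G2 := ground_of R2.

Definition union_graph : graph :=
  @Graph (nodes G1 + nodes G2)%type (arcs G1 + arcs G2)%type
    (fun a => match a with inl a => inl (tail a) | inr a => inr (tail a) end)
    (fun a => match a with inl a => inl (head a) | inr a => inr (head a) end).

Definition union_ground : ground :=
  @Ground union_graph
    (fun n => match n with inl n => lab n | inr n => lab n end)
    ([seq inl a | a <- concls G1] ++ [seq inr a | a <- concls G2])
    (fun n => match n with
              | inl n => [seq inl a | a <- bang_concls n]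
              | inr n => [seq inr a | a <- bang_concls n] end)
    (fun n => match n with
              | inl n => [seq inl a | a <- prems n]
              | inr n => [seq inr a | a <- prems n] end).

Definition ps_union : proof_structure :=
  @PS union_ground
    (fun a => match a with inl a => type_of a | inr a => type_of a end)
    (fun n => match n return is_bang (@lab union_ground n) -> _ with
              | inl n => @box_of R1 n
              | inr n => @box_of R2 n end).
End DisjointUnion.

(* [add_node s b tyK c] adds to R a node, [inr None], labelled by l.  Its
   premises are the conclusions s of R, whose former heads (conclusion nodes)
   are replaced by the new node.  Its conclusions are indexed by K, with types
   tyK, and each of them is the premise of a new conclusion node
   [inr (Some k)].  If l is a ! then b is its box.  The conclusions of the
   result are ordered by c. *)
Section AddNode.
Variables (R : proof_structure) (s : seq (arcs (ground_of R))).
Variables (l : label) (b : is_bang l -> proof_structure).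
Variables (K : finType) (tyK : K -> formula).
Variable c : seq (arcs (ground_of R) + K).
Let G := ground_of R.

Definition kept_node : finType := {n : nodes G | n \notin map (@head G) s}.

Definition relocate (n : nodes G) : kept_node + option K :=
  if insub n is Some m then inl m else inr None.

Definition add_graph : graph :=
  @Graph (kept_node + option K)%type (arcs G + K)%type
    (fun a => match a with
              | inl a => relocate (tail a) | inr _ => inr None end)
    (fun a => match a with
              | inl a => relocate (head a) | inr k => inr (Some k) end).

Definition add_ground : ground :=
  @Ground add_graph
    (fun n => match n with
              | inl m => lab (val m)
              | inr None => l
              | inr (Some _) => Lconc end)
    c
    (fun n => match n with
              | inl m => [seq inl a | a <- bang_concls (val m)]
              | inr None => [seq inr k | k <- enum K]
              | inr (Some _) => [::] end)
    (fun n => match n with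
              | inl m => [seq inl a | a <- prems (val m)]
              | inr None => [seq inl a | a <- s]
              | inr (Some _) => [::] end).

Definition add_node : proof_structure :=
  @PS add_ground
    (fun a => match a with inl a => type_of a | inr k => tyK k end)
    (fun n => match n return is_bang (@lab add_ground n) -> _ with
              | inl m => @box_of R (val m)
              | inr None => b
              | inr (Some _) => nobox end).
End AddNode.

Definition ps_exchange (R : proof_structure) (sigma : seq nat) :
    proof_structure :=
  let: PS G ty box := R in
  @PS (@Ground G (@lab G) (permute (concls G) sigma)
         (@bang_concls G) (@prems G)) ty box.

Fixpoint deseq (Gamma : seq formula) (pi : proof Gamma) : proof_structure :=
  match pi with
  | p_ax A =>
      @add_node ps_empty [::] Lax nobox bool
        (fun k => if k then A else dual A) [:: inr true; inr false]
  | p_one =>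
      @add_node ps_empty [::] Lone nobox unit (fun=> One) [:: inr tt]
  | p_cut Gamma _ _ pi1 pi2 =>
      let R1 := deseq pi1 in
      let R2 := deseq pi2 in
      let c1 := [seq inl a | a <- concls_of R1] in
      let c2 := [seq inr a | a <- concls_of R2] in
      let g := size Gamma in
      @add_node (ps_union R1 R2) (drop g c1 ++ take 1 c2) Lcut nobox
        void (fun k => match k with end)
        [seq inl a | a <- take g c1 ++ drop 1 c2]
  | p_tens Gamma _ A B pi1 pi2 =>
      let R1 := deseq pi1 in
      let R2 := deseq pi2 in
      let c1 := [seq inl a | a <- concls_of R1] in
      let c2 := [seq inr a | a <- concls_of R2] in
      let g := size Gamma in
      @add_node (ps_union R1 R2) (drop g c1 ++ take 1 c2) Ltens nobox
        unit (fun=> Tens A B)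
        ([seq inl a | a <- take g c1] ++ inr tt :: [seq inl a | a <- drop 1 c2])
  | p_bot _ pi1 =>
      let R1 := deseq pi1 in
      @add_node R1 [::] Lbot nobox unit (fun=> Bot)
        ([seq inl a | a <- concls_of R1] ++ [:: inr tt])
  | p_par Gamma A B pi1 =>
      let R1 := deseq pi1 in
      @add_node R1 (drop (size Gamma) (concls_of R1)) Lpar nobox
        unit (fun=> Par A B)
        ([seq inl a | a <- take (size Gamma) (concls_of R1)] ++ [:: inr tt])
  | p_der Gamma A pi1 =>
      let R1 := deseq pi1 in
      @add_node R1 (drop (size Gamma) (concls_of R1)) Lder nobox
        unit (fun=> WhyNot A)
        ([seq inl a | a <- take (size Gamma) (concls_of R1)] ++ [:: inr tt])
  | p_why Gamma A _ pi1 =>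
      let R1 := deseq pi1 in
      @add_node R1 (drop (size Gamma) (concls_of R1)) Lwhy nobox
        unit (fun=> WhyNot A)
        ([seq inl a | a <- take (size Gamma) (concls_of R1)] ++ [:: inr tt])
  | p_bang Gamma A pi1 =>
      let t := in_tuple (map WhyNot Gamma ++ [:: OfCourse A]) in
      @add_node ps_empty [::] Lbang (fun=> deseq pi1) 'I_(size t) (tnth t)
        [seq inr k | k <- enum 'I_(size t)]
  | p_exch _ sigma _ pi1 => ps_exchange (deseq pi1) sigma
  end.

Definition sequentializable (F : fragment) (R : proof_structure) : Prop :=
  exists (Gamma : seq formula) (pi : proof Gamma),
    proof_in F pi /\ ps_equal R (deseq pi).

Fixpoint at_every_depth (P : forall G : ground, (arcs G -> formula) -> Prop)
    (R : proof_structure) : Prop :=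
  let: PS G ty box := R in
  P G ty /\
  forall (n : nodes G) (h : is_bang (lab n)), at_every_depth P (box n h).

Section SharpW.
Variable G : ground.

Definition w_nodes : {set nodes G} :=
  [set n | (lab n == Lbot) || is_weakening n].

Definition switched (n : nodes G) : bool := (lab n == Lpar) || is_contraction n.

Definition is_switching (phi : {n : nodes G | switched n} -> arcs G) : Prop :=
  forall m, phi m \in premises (val m).

Definition switching_graph (phi : {n : nodes G | switched n} -> arcs G) :
    graph :=
  @keep_arcs G (fun a => if insub (head a) is Some m then a == phi m else true).

Definition ground_ACC_w : Prop :=
  forall phi, is_switching phi ->
    acyclic (switching_graph phi) /\
    #|cc (switching_graph phi)| = #|w_nodes| + 1.
End SharpW.

Section InputOutput.
Variables (G : ground) (ty : arcs G -> formula).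

Definition output (a : arcs G) : bool := positive (ty a).
Definition input (a : arcs G) : bool := negative (ty a).

Definition par_o (n : nodes G) : bool :=
  (lab n == Lpar) && [exists c in conclusions n, output c].

Definition d_c : {set nodes G} :=
  [set n | (lab n == Lder) && [exists a in premises n, output a]].

Definition o_nodes : {set nodes G} :=
  [set n | (lab n == Lconc) && [exists a in premises n, output a]].

Definition io_graph : graph :=
  let kept := fun a : arcs G => ~~ (par_o (head a) && input a) in
  reverse_arcs (G := keep_arcs kept) (fun a => input (val a)).

Definition ground_ACC_io : Prop :=
  directed_acyclic io_graph /\ #|d_c| + #|o_nodes| = 1.
End InputOutput.

Definition ACC_w : proof_structure -> Prop :=
  at_every_depth (fun G _ => ground_ACC_w G).

Definition ACC_io : proof_structure -> Prop :=
  at_every_depth (fun G ty => ground_ACC_io ty).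

(* Main.v *)
From mathcomp Require Import all_boot zify.
Require Import Defs.

Set Implicit Arguments.
Unset Strict Implicit.
Unset Printing Implicit Defensive.

(** Orient every arc along its polarity: outputs downwards, inputs upwards.
    Once a switching is applied, every node has at most one outgoing arc, and it
    has none exactly when it is a bottom, a weakening, a dereliction or an output
    conclusion.  A switching graph is thus the graph of a partial function on
    nodes: its cycles are directed cycles and, when there are none, its connected
    components are in bijection with the nodes without outgoing arc.  As a
    directed cycle of the whole structure survives in some switching, the two
    criteria agree.

    To sequentialize, remove a terminal bottom, par, ? or ?d node as long as there
    is one.  Otherwise consider a cut with no cut above it for the orientation or,
    if there is no cut, a terminal tensor: all the ancestors of its output premise
    have a single outgoing arc, so they form a tree attached to the rest of the
    structure by this premise only, and the structure splits.

    Conversely, a rank function increasing along the orientation is built by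
    induction on a sequent calculus proof. *)

(** * Cycles, ranks and forests *)

(** Acyclicity is used throughout as a rank [r] on nodes, strictly increasing along the orientation:
    it selects maximal nodes and minimal cuts, and ranks of subproofs can be combined.

    Deleting nodes from a dependently typed structure would force a renaming at every
    sequentialization step. The decomposition therefore runs over sets [S] of nodes of one fixed
    ground-structure: [derivable S c] means that some proof desequentializes to a copy of [S] whose
    outgoing arcs, in the order [c], are the conclusions. An actual renaming is assembled only once,
    for the set of all nodes that are not conclusion nodes.

    The invariant is that the ?d nodes of [S] and the outputs leaving [S] are one in total. A ?d
    node counts because removing it exposes its output premise. At a cut, the tree above the output
    premise has this premise as its only output, and the other side inherits the count of [S].
    Without cuts and terminal negative nodes, no ?d node is left, and the unique output points to
    the tensor to split or to the last axiom, one or box. *)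

Section Orientation.
Variables (H : graph) (src tgt : arcs H -> nodes H).

Definition step : rel (nodes H) :=
  fun x y => [exists a, (src a == x) && (tgt a == y)].

Lemma step_arc a : step (src a) (tgt a).
Proof. by apply/existsP; exists a; rewrite !eqxx. Qed.

Let slink (a : arcs H) (x y : nodes H) := (src a == x) && (tgt a == y).

Lemma walk_of_path x p :
  path step x p -> exists2 q, walk slink x q & unzip2 q = p.
Proof.
elim: p x => [|y p IHp] x /=; first by exists [::].
case/andP=> /existsP[a sa] /IHp[q wq <-].
by exists ((a, y) :: q) => //=; apply/andP.
Qed.

Lemma walk_rcons (link : arcs H -> rel (nodes H)) x q a (y : nodes H) :
  walk link x (rcons q (a, y)) =
    walk link x q && link a (last x (unzip2 q)) y.
Proof.
elim: q x => [|[b z] q IHq] x /=; first by rewrite andbT.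
by rewrite IHq andbA.
Qed.

Lemma sub_walk (link link' : arcs H -> rel (nodes H)) x q :
  (forall a x y, link a x y -> link' a x y) ->
  walk link x q -> walk link' x q.
Proof.
move=> sub; elim: q x => [|[a y] q IHq] x //= /andP[/sub-> /IHq].
by [].
Qed.

(** [link] is abstract because two kinds of cycle are extracted: directed ones with [dlink] and, for
    an orientation that may differ from [tail] and [head], undirected ones with [ulink]. Shortening
    the way back makes the cycle simple. *)
Lemma cycle_of_step (link : arcs H -> rel (nodes H)) x y :
  (forall a, link a (src a) (tgt a)) -> step x y -> connect step y x ->
  exists n0 p, is_cycle link n0 p.
Proof.
move=> hl /existsP[a0 sa0] /connectP[p0 /shortenP[p pp Up _] eq_x].
have [q wq eq_p] := walk_of_path pp.
have wP : walk slink x ((a0, y) :: q) by rewrite /= {1}/slink sa0.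
have eqP2 : unzip2 ((a0, y) :: q) = y :: p by rewrite /= eq_p.
have szP : size ((a0, y) :: q) = size (y :: p) by rewrite -eqP2 size_map.
exists x, ((a0, y) :: q); split; [split|by []|by rewrite eqP2].
- by apply: sub_walk wP => a u v /andP[/eqP<- /eqP<-].
- rewrite eqP2 szP.
  have last_x : x = nth x (y :: p) (size p) by rewrite nth_last.
  move=> [|i] [|j] //= le_i le_j neq_ij.
  + rewrite {1}last_x => /eqP; rewrite nth_uniq //= => /eqP->; by left.
  + rewrite {2}last_x => /eqP; rewrite nth_uniq //= => /eqP->; by right.
  + by move/eqP; rewrite nth_uniq // => /eqP eq_ij; case: neq_ij; rewrite eq_ij.
(* If the first and last arcs were equal, [x] would occur twice on the duplicate-free way back: as
   its end [z] and as the source of its last arc. *)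
- move=> a b k_ge2 [<-]; move: k_ge2 wP eqP2.
  case/lastP: q {wq eq_p szP} => [|q [c z]] //= _.
  rewrite walk_rcons /unzip1 map_rcons rev_cons rev_rcons /=.
  rewrite /unzip2 map_rcons /= => /andP[/andP[/eqP sa _] /andP[wq sc]].
  case=> eq_p [<-] eq_ac; move: Up; rewrite -eq_p /=.
  move: sc; rewrite /slink -eq_ac sa => /andP[/eqP sl _].
  have: x \in y :: unzip2 q by rewrite sl mem_last.
  have -> : x = z by rewrite eq_x -eq_p last_rcons.
  by rewrite inE mem_rcons inE rcons_uniq => /orP[/eqP->|->]; rewrite ?eqxx ?andbF.
Qed.

Lemma rank_of_acyclic (link : arcs H -> rel (nodes H)) :
  (forall a, link a (src a) (tgt a)) ->
  (forall n0 p, ~ is_cycle link n0 p) ->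
  exists r : nodes H -> nat, forall a, r (src a) < r (tgt a).
Proof.
(* The rank of [x] is the number of nodes that reach it. It grows strictly along [a] because [tgt a]
   reaches itself but, for lack of cycles, not [src a]. *)
move=> hl acyc; exists (fun x => #|[set y | connect step y x]|) => a.
apply/proper_card/properP; split.
  apply/subsetP=> y; rewrite !inE => /connect_trans; apply.
  exact/connect1/step_arc.
exists (tgt a); rewrite inE ?connect0 //; apply/negP.
by case/(cycle_of_step hl (step_arc a)) => n0 [p /acyc].
Qed.

End Orientation.

Lemma directed_acyclic_of_rank (H : graph) (r : nodes H -> nat) :
  (forall a : arcs H, r (tail a) < r (head a)) -> directed_acyclic H.
Proof.
move=> r_lt x p [[wp _ _] p_gt0 lastp].
have le_r q z : walk (@dlink H) z q -> r z + size q <= r (last z (unzip2 q)).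
  elim: q z => [|[a y] q IHq] z /=; first by rewrite addn0.
  by case/andP=> /andP[/eqP<- /eqP<-] /IHq; have := r_lt a; lia.
by have := le_r _ _ wp; rewrite lastp; lia.
Qed.

Section Forest.
Variables (H : graph) (src tgt : arcs H -> nodes H) (r : nodes H -> nat).
Hypothesis orient : forall a : arcs H,
  (src a = tail a /\ tgt a = head a) \/ (src a = head a /\ tgt a = tail a).
Hypothesis src_inj : injective src.
Hypothesis r_lt : forall a, r (src a) < r (tgt a).

Lemma ulink_orient a x y : ulink a x y ->
  (src a = x /\ tgt a = y) \/ (src a = y /\ tgt a = x).
Proof.
by case/orP=> /andP[/eqP<- /eqP<-]; case: (orient a) => -[-> ->];
   [left|right|right|left].
Qed.

(* A reduced walk climbs first and descends afterwards. *)
Lemma forest_walk x a y p : walk (@ulink H) x ((a, y) :: p) ->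
  sorted (fun a b => a != b) (a :: unzip1 p) ->
  (src a = x /\ r x < r (last y (unzip2 p))) \/
  (src (last a (unzip1 p)) = last y (unzip2 p) /\
    (src a = x \/ r (last y (unzip2 p)) < r x)).
Proof.
elim: p x a y => [|[b z] p IHp] x a y /=.
  rewrite andbT => /ulink_orient[][<- <-] _; first by left.
  by right; split=> //; right.
case/andP=> la wbp /andP[ab sp].
case/ulink_orient: la => -[sa ta]; have := r_lt a; rewrite sa ta => r_xy.
  have [[_ lt_r]|[sl _]] := IHp _ _ _ wbp sp; last by right; split=> //; left.
  by left; split=> //; apply: ltn_trans lt_r.
have sb : src b <> y by rewrite -sa => /src_inj eq_ba; rewrite eq_ba eqxx in ab.
have [[]|[sl [|lt_r]]] // := IHp _ _ _ wbp sp.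
by right; split=> //; right; apply: ltn_trans r_xy.
Qed.

Lemma ulink_back (a : arcs H) x y z : ulink a x y -> ulink a y z -> x = z.
Proof.
move=> /orP[] /andP[/eqP h1 /eqP h2] /orP[] /andP[/eqP h3 /eqP h4];
  congruence.
Qed.

(** A cycle is a reduced walk: equal consecutive arcs would identify [n_i] with [n_{i+2}], which
    forces a cycle of length 2 with [a_1 = a_k]. As it returns to its starting rank, it must climb
    out of [x] and come back down to [x]; its first and last arcs both have source [x], hence
    coincide. A loop is excluded by the rank. *)
Lemma forest_acyclic : acyclic H.
Proof.
move=> x p [[wp simple ends] p_gt0 lastp].
have red : sorted (fun a b => a != b) (unzip1 p).
  case: p wp simple ends p_gt0 lastp => [|[a y] p] // wp simple ends _ _.
  apply/(sortedP a) => i; rewrite size_map => lt_i; apply/eqP=> eq_a.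
  have walk_nth j q w : walk (@ulink H) w q -> j < size q ->
    ulink (nth a (unzip1 q) j) (nth x (w :: unzip2 q) j)
      (nth x (w :: unzip2 q) j.+1).
    elim: q w j => [|[b z] q IHq] w [|j] //= /andP[// lb wq] lt_j.
    by have := IHq _ _ wq lt_j; case: j {lt_j}.
  have h1 := walk_nth i _ _ wp (ltnW lt_i).
  have h2 := walk_nth i.+1 _ _ wp lt_i.
  rewrite -eq_a in h2; have eq_n := ulink_back h1 h2.
  have neq_i : i <> i.+2 by lia.
  have [[i0 sz]|[]//] := simple i i.+2 (ltnW (ltnW lt_i)) lt_i neq_i eq_n.
  move: sz eq_a ends; rewrite {}i0.
  case: p {wp simple h1 h2 lt_i eq_n} => [|[b z] [|? ?]] //= _ <-.
  by move/(_ a a isT erefl erefl).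
case: p wp ends p_gt0 lastp red {simple} => [|[a y] p] // wp ends _ /= lastp red.
move: (forest_walk wp red); rewrite lastp ltnn => -[[]|[sl [sa|]]] //.
move: wp ends; case/lastP: p lastp sl {red} => [|p [b z]] lastp sl.
  rewrite /= andbT => /ulink_orient[] [sx tx] _; have := r_lt a;
    by rewrite sx tx -{1}lastp ltnn.
move=> _ /(_ a b); rewrite /unzip1 map_cons map_rcons rev_cons rev_rcons.
rewrite /= size_rcons => /(_ isT erefl erefl); apply; apply: src_inj.
by rewrite sa -sl /unzip1 map_rcons last_rcons.
Qed.

Let roots := [set n | [forall a, src a != n]].
Let comp (n : nodes H) := [set m | connect (@adjacent H) n m].

Lemma adjacent_orient x y :
  adjacent x y = step src tgt x y || step src tgt y x.
Proof.
apply/existsP/orP=> [[a /ulink_orient[[<- <-]|[<- <-]]]|].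
- by left; apply: step_arc.
- by right; apply: step_arc.
- by case=> /existsP[a /andP[/eqP<- /eqP<-]]; exists a; rewrite /ulink /dlink;
    case: (orient a) => -[-> ->]; rewrite !eqxx ?orbT.
Qed.

Lemma adjacent_sym : symmetric (@adjacent H).
Proof. by move=> x y; rewrite !adjacent_orient orbC. Qed.

Lemma root_above n : exists2 z, z \in roots & connect (@adjacent H) n z.
Proof.
have [z nz z_max] := @arg_maxnP _ n (fun m => connect (@adjacent H) n m) r (connect0 _ n).
exists z => //; rewrite inE; apply/forallP=> a; apply/eqP=> sa.
suff: r (tgt a) <= r z by rewrite -sa leqNgt r_lt.
apply/z_max/(connect_trans nz)/connect1.
by rewrite adjacent_orient -sa step_arc.
Qed.

(** The nodes that climb to [z] are closed under adjacency: a node other than [z] can only climb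
    along its unique outgoing arc. So [y] climbs to [z], and a root climbs nowhere but to itself. *)
Lemma connected_roots y z :
  y \in roots -> z \in roots -> connect (@adjacent H) y z -> y = z.
Proof.
rewrite !inE => /forallP ry /forallP rz.
have closed_z : closed (@adjacent H) [pred x | connect (step src tgt) x z].
  apply: intro_closed => [|u v]; first exact/sym_connect_sym/adjacent_sym.
  rewrite adjacent_orient !inE => /orP[/existsP[a /andP[/eqP su /eqP tv]]|vu].
    case/connectP=> -[_ zu|w p /= /andP[/existsP[b /andP[/eqP sb /eqP tb]]] pw ->].
      by move: (rz a); rewrite su zu eqxx.
    by rewrite -tv (src_inj (etrans su (esym sb))) tb; apply/connectP; exists p.
  exact/connect_trans/connect1.
move/(closed_connect closed_z); rewrite !inE connect0 => /connectP[[//|w p /=]].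
by case/andP=> /existsP[a]; rewrite (negPf (ry a)).
Qed.

Lemma card_cc_forest : #|cc H| = #|roots|.
Proof.
have -> : cc H = comp @: roots.
  apply/setP=> C; apply/imsetP/imsetP=> -[n _ ->]; last by exists n.
  have [z rz nz] := root_above n; exists z => //; apply/setP=> m; rewrite !inE.
  exact: (same_connect (sym_connect_sym adjacent_sym)).
apply: card_in_imset => y z ry rz /setP/(_ z); rewrite !inE connect0.
by apply: connected_roots.
Qed.

End Forest.

(** * Equivalence of the two criteria *)

Lemma set2_of_card (T : finType) (A : {set T}) a b :
  #|A| = 2 -> a \in A -> b \in A -> a != b -> A = [set a; b].
Proof.
move=> cA aA bA ab; apply/esym/eqP; rewrite eqEcard cards2 ab cA andbT.
by apply/subsetP=> x; rewrite !inE => /orP[]/eqP->.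
Qed.

Lemma negative_npos A : MELLpol A -> negative A = ~~ positive A.
Proof. by rewrite /MELLpol; case: A => //= [A B|A B|A|A]; rewrite ?orbF => ->. Qed.

Lemma dual_polarity A :
  (positive (dual A) = negative A) * (negative (dual A) = positive A).
Proof. by elim: A => //= A [IH1 IH2] => [B [IH3 IH4]|B [IH3 IH4]||];
  rewrite ?(IH1, IH2, IH3, IH4). Qed.

Lemma not_polarized_both A : positive A -> negative A = false.
Proof. by case: A. Qed.

(** The share of the typing of ! nodes that concerns one ground-structure, detached from the boxes
    so that polarity arguments need not mention them. *)
Definition bang_typed (G : ground) (ty : arcs G -> formula) : Prop :=
  forall n : nodes G, lab n = Lbang -> exists As A,
    [seq ty a | a <- bang_concls n] = map WhyNot As ++ [:: OfCourse A].

Section Polarized.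
Variables (G : ground) (ty : arcs G -> formula).
Hypothesis groundG : is_ground_structure G.
Hypothesis polG : forall a, MELLpol (ty a).
Hypothesis typedG : forall n, node_typed ty n.
Hypothesis bangG : bang_typed ty.

Let arityG (n : nodes G) : arity (lab n) #|premises n| #|conclusions n|.
Proof. by case: groundG. Qed.

Lemma card_premise (a : arcs G) : 0 < #|premises (head a)|.
Proof. by apply/card_gt0P; exists a; rewrite inE. Qed.

Lemma card_conclusion (a : arcs G) : 0 < #|conclusions (tail a)|.
Proof. by apply/card_gt0P; exists a; rewrite inE. Qed.

Lemma conclusion_of (n : nodes G) : 0 < #|conclusions n| -> exists c, tail c = n.
Proof. by case/card_gt0P=> c; rewrite inE => /eqP; exists c. Qed.

Lemma premise_of (n : nodes G) : 0 < #|premises n| -> exists c, head c = n.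
Proof. by case/card_gt0P=> c; rewrite inE => /eqP; exists c. Qed.

Lemma conclusion_unique (a b : arcs G) :
  #|conclusions (tail a)| = 1 -> tail a = tail b -> a = b.
Proof.
move=> c1 eq_t; have /card_le1_eqP: #|conclusions (tail a)| <= 1 by rewrite c1.
by apply; rewrite inE // eq_t.
Qed.

Lemma premise_unique (a b : arcs G) :
  #|premises (head a)| = 1 -> head a = head b -> a = b.
Proof.
move=> c1 eq_t; have /card_le1_eqP: #|premises (head a)| <= 1 by rewrite c1.
by apply; rewrite inE // eq_t.
Qed.

Lemma mem_prems (a : arcs G) : lab (head a) \in [:: Ltens; Lpar] -> a \in prems (head a).
Proof. by case: groundG => _ _ _ h /h[_ ->]; rewrite inE. Qed.

(** Polarization propagates from a conclusion to the premises, since a compound formula of the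
    fragment has components of prescribed polarities. The value [false] stands for labels without
    premises, [true] for labels that impose nothing. *)
Lemma premise_polarity (a : arcs G) :
  match lab (head a) with
  | Ltens | Lder => positive (ty a)
  | Lpar | Lwhy => negative (ty a)
  | Lcut | Lconc => true
  | _ => false
  end.
Proof.
have := arityG (head a); have := typedG (head a); have := card_premise a.
have := @mem_prems a; rewrite /node_typed.
case El: (lab (head a)) => //=; rewrite ?inE /=; try by move=> _; case: #|premises _|.
- move=> /(_ isT) Pa _ typ /andP[_ /eqP c1].
  have [c tc] : exists c, tail c = head a by apply: conclusion_of; rewrite c1.
  have [A [B [eqAB tyc]]] := typ c tc.
  have := polG c; rewrite tyc /MELLpol /= => /andP[pA pB].
  move: pA pB; case: (prems (head a)) eqAB Pa => [|a1 [|a2 [|? ?]]] //= [<- <-].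
  by rewrite !inE => /orP[] /eqP->.
- move=> /(_ isT) Pa _ typ /andP[_ /eqP c1].
  have [c tc] : exists c, tail c = head a by apply: conclusion_of; rewrite c1.
  have [A [B [eqAB tyc]]] := typ c tc.
  have := polG c; rewrite tyc /MELLpol /= orbF => /andP[pA pB].
  move: pA pB; case: (prems (head a)) eqAB Pa => [|a1 [|a2 [|? ?]]] //= [<- <-].
  by rewrite !inE => /orP[] /eqP->.
- move=> _ _ typ /andP[_ /eqP c1].
  have [c tc] : exists c, tail c = head a by apply: conclusion_of; rewrite c1.
  by have := polG c; rewrite (typ a c) // /MELLpol /= orbF.
- move=> _ _ [A /(_ a (or_introl erefl)) tya] _.
  by have := polG a; rewrite tya /MELLpol /= orbF.
Qed.

Lemma conclusion_polarity (a : arcs G) :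
  match lab (tail a) with
  | Lone | Ltens => positive (ty a)
  | Lbot | Lpar | Lder | Lwhy => negative (ty a)
  | Lax | Lbang => true
  | Lcut | Lconc => false
  end.
Proof.
have := arityG (tail a); have := typedG (tail a); have := card_conclusion a.
rewrite /node_typed; have := polG a.
case El: (lab (tail a)) => //= polA c0;
  try by move=> _ /andP[_ /eqP c1]; rewrite c1 in c0.
- by move/(_ a erefl)->.
- by move/(_ a erefl)->.
- by case/(_ a erefl)=> A [B [_ tya]] _; move: polA; rewrite tya.
- by case/(_ a erefl)=> A [B [_ tya]] _; move: polA; rewrite tya /MELLpol /= orbF.
- move=> typ /andP[/eqP p1 _].
  have [c tc] : exists c, head c = tail a by apply: premise_of; rewrite p1.
  by move: polA; rewrite (typ c a) // /MELLpol /= orbF.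
- by case=> A /(_ a (or_intror erefl)) tya; move: polA; rewrite tya /MELLpol /= orbF.
Qed.

Definition io_src (a : arcs G) := if negative (ty a) then head a else tail a.
Definition io_tgt (a : arcs G) := if negative (ty a) then tail a else head a.

(** Indexed so that one case analysis on [io_srcP] settles both polarity tests and both ends at
    once. *)
Variant io_src_spec a : bool -> bool -> nodes G -> nodes G -> Type :=
  | IoInput of negative (ty a) : io_src_spec a true false (head a) (tail a)
  | IoOutput of positive (ty a) : io_src_spec a false true (tail a) (head a).

Lemma io_srcP (a : arcs G) :
  io_src_spec a (negative (ty a)) (positive (ty a)) (io_src a) (io_tgt a).
Proof.
rewrite /io_src /io_tgt; have := negative_npos (polG a).
by case En: (negative _); case Ep: (positive _) => // _; constructor.
Qed.

Lemma output_ninput (a : arcs G) : positive (ty a) = ~~ negative (ty a).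
Proof. by rewrite negative_npos ?negbK. Qed.

Lemma io_orient (a : arcs G) :
  (io_src a = tail a /\ io_tgt a = head a) \/
  (io_src a = head a /\ io_tgt a = tail a).
Proof. by case: io_srcP; [right|left]. Qed.

Lemma bang_output_unique (n : nodes G) : lab n = Lbang ->
  exists2 a, tail a = n /\ positive (ty a) &
    forall b, tail b = n -> positive (ty b) -> b = a.
Proof.
move=> ln; have [As [A]] := bangG ln; case: groundG => _ _ /(_ n ln)[_ memB] _.
move: (bang_concls n) memB => s; case/lastP: s => [|s a]; first by case: As.
move=> memB; rewrite map_rcons cats1 => /rcons_inj[eqs eqa].
exists a.
  split; first by apply/eqP; have := memB a; rewrite mem_rcons mem_head inE.
  by have := polG a; rewrite eqa.
move=> b tb pb; have: b \in rcons s a by rewrite memB inE tb.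
rewrite mem_rcons inE => /predU1P[//|bs].
have: all (fun b => negative (ty b)) s.
  have: all (fun b => MELLpol (ty b)) s by apply/allP=> x _; apply: polG.
  rewrite -!(all_map ty) eqs; elim: As {eqs} => //= B As IHs /andP[].
  by rewrite /MELLpol /= orbF => -> /IHs.
by move/allP/(_ b bs); rewrite /= (not_polarized_both pb).
Qed.

(** Only par and ? nodes may have several outgoing arcs, as their premises are inputs and so leave
    them upwards. At an axiom or a cut, duality lets exactly one of the two arcs out; at a ! node
    only the principal port is an output. *)
Lemma io_src_unique (a b : arcs G) : io_src a = io_src b ->
  lab (io_src a) \notin [:: Lpar; Lwhy] -> a = b.
Proof.
move=> eq_ab; move Dn: (io_src a) eq_ab => n eq_ab.
have := typedG n; have := arityG n; rewrite /node_typed.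
have := premise_polarity a; have := conclusion_polarity a.
have := premise_polarity b; have := conclusion_polarity b.
move: Dn eq_ab; case: io_srcP => [Na|Pa]; case: io_srcP => [Nb|Pb] => /= Da Db;
  rewrite ?Da -?Db; case En: (lab n) => //;
  rewrite ?(not_polarized_both Pa) ?(not_polarized_both Pb) // ?inE /=.
- move=> _ _ _ _ _ typ _; apply/eqP/contraT=> /eqP neq_ab.
  have := typ a b Da (esym Db) neq_ab => /(congr1 positive).
  by rewrite dual_polarity Na output_ninput Nb.
- by move=> _ _ _ _ /andP[/eqP c1 _] _ _; apply: premise_unique; rewrite Da.
- move=> _ _ _ _ _ typ _; apply/eqP/contraT=> /eqP neq_ab.
  have := typ a b Da (esym Db) neq_ab => /(congr1 negative).
  by rewrite dual_polarity Pa (not_polarized_both Pb).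
- by move=> _ _ _ _ /andP[_ /eqP c1] _ _; apply: conclusion_unique; rewrite Da.
- by move=> _ _ _ _ /andP[_ /eqP c1] _ _; apply: conclusion_unique; rewrite Da.
- have [c _ uc] := bang_output_unique En => _ _ _ _ _ _ _.
  by rewrite (uc a) // (uc b).
Qed.

Lemma io_src_switch (a : arcs G) :
  lab (io_src a) \in [:: Lpar; Lwhy] -> head a = io_src a.
Proof.
case: io_srcP => // Pa; have := conclusion_polarity a.
by case: (lab (tail a)) => //; rewrite (not_polarized_both Pa).
Qed.

(** By [sinkP], the nodes without outgoing arc. Components of a switching graph being counted by
    them, [card_sinks] turns the two counting clauses of the criteria into the same equation. *)
Definition sinks : {set nodes G} := w_nodes G :|: (d_c ty :|: o_nodes ty).

Lemma card_sinks : #|sinks| = #|w_nodes G| + (#|d_c ty| + #|o_nodes ty|).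
Proof.
rewrite /sinks cardsU disjoint_setI0 ?cards0 ?subn0; last first.
  rewrite disjoints_subset; apply/subsetP=> n; rewrite !inE /is_weakening.
  by case: (lab n).
rewrite cardsU disjoint_setI0 ?cards0 ?subn0 //.
rewrite disjoints_subset; apply/subsetP=> n; rewrite !inE.
by case: (lab n).
Qed.

Lemma sinkP (n : nodes G) : reflect (forall a, io_src a != n) (n \in sinks).
Proof.
apply: (iffP idP) => [sn a|no_out].
  apply/eqP=> Dn; move: sn; rewrite !inE /is_weakening; move: Dn.
  have := premise_polarity a; have := conclusion_polarity a.
  case: io_srcP => [Na|Pa] pc pp <-; last first.
    by case El: (lab (tail a)) pc; rewrite //= (not_polarized_both Pa).
  case El: (lab (head a)) pp; rewrite //= ?output_ninput ?Na //= => _.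
    by rewrite orbF => /eqP p0; have := card_premise a; rewrite p0.
  case/existsP=> b; rewrite inE => /andP[/eqP eq_h].
  have := arityG (head a); rewrite El => /andP[/eqP p1 _].
  by rewrite -(premise_unique p1 (esym eq_h)) /output output_ninput Na.
apply/contraT; rewrite !inE /is_weakening.
have no_in a : head a = n -> negative (ty a) -> False.
  by move=> ha Na; have := no_out a; rewrite /io_src Na ha eqxx.
have no_out_concl a : tail a = n -> ~~ negative (ty a) -> False.
  by move=> ta Na; have := no_out a; rewrite /io_src (negPf Na) ta eqxx.
have := arityG n; have := typedG n; rewrite /node_typed.
case En: (lab n) => //=.
- move=> typ /andP[_ /eqP c2] _.
  have /card_gt1P[a [b]]: 1 < #|conclusions n| by rewrite c2.
  rewrite !inE => -[/eqP ta /eqP tb /eqP ab]; case: (no_out_concl a ta).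
  apply/negP=> Na; apply: (no_out_concl b tb).
  by rewrite (typ a b) // dual_polarity output_ninput Na.
- move=> typ /andP[/eqP p2 _] _.
  have /card_gt1P[a [b]]: 1 < #|premises n| by rewrite p2.
  rewrite !inE => -[/eqP ha /eqP hb /eqP ab]; case: (no_in b hb).
  rewrite (typ a b) // dual_polarity output_ninput.
  by apply/negP=> /(no_in a ha).
- move=> _ /andP[_ /eqP c1] _.
  have [c tc] : exists c, tail c = n by apply: conclusion_of; rewrite c1.
  have := conclusion_polarity c; rewrite tc En output_ninput.
  by move/(no_out_concl c tc).
- move=> _ /andP[_ /eqP c1] _.
  have [c tc] : exists c, tail c = n by apply: conclusion_of; rewrite c1.
  have := conclusion_polarity c; rewrite tc En output_ninput.
  by move/(no_out_concl c tc).
- move=> _ /andP[/eqP p2 _] _.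
  have [c hc] : exists c, head c = n by apply: premise_of; rewrite p2.
  by have := premise_polarity c; rewrite hc En => /(no_in c hc).
- move=> _ _ _; have [c [tc]] := bang_output_unique En.
  by rewrite output_ninput => /(no_out_concl c tc).
- move=> _ /andP[/eqP p1 _].
  have [c hc] : exists c, head c = n by apply: premise_of; rewrite p1.
  rewrite orbF => /existsP[]; exists c; rewrite inE hc eqxx.
  by have := premise_polarity c; rewrite hc En.
- move=> _ _; rewrite !orbF -lt0n => /premise_of[c hc].
  by have := premise_polarity c; rewrite hc En => /(no_in c hc).
- move=> _ /andP[/eqP p1 _].
  have [c hc] : exists c, head c = n by apply: premise_of; rewrite p1.
  move/existsP=> []; exists c; rewrite inE hc eqxx /output output_ninput.
  by apply/negP=> /(no_in c hc).
Qed.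

Lemma no_par_o (n : nodes G) : par_o ty n = false.
Proof.
apply/andP=> -[/eqP ln /existsP[c]]; rewrite inE => /andP[/eqP tc].
have := conclusion_polarity c; rewrite tc ln /output output_ninput => ->.
by [].
Qed.

(** By [no_par_o] no arc is erased, so [io_graph] is the whole graph oriented by [io_src] and
    [io_tgt]. *)
Lemma io_directed_acyclicP :
  directed_acyclic (io_graph ty) <->
  exists r : nodes G -> nat, forall a, r (io_src a) < r (io_tgt a).
Proof.
split=> [acyc|[r r_lt]].
  have kept (a : arcs G) : ~~ (par_o ty (head a) && input ty a) by rewrite no_par_o.
  have [|r r_lt] := @rank_of_acyclic (io_graph ty) (@tail _) (@head _) (@dlink _) _ acyc.
    by move=> a; rewrite /dlink !eqxx.
  by exists r => a; apply: (r_lt (Sub a (kept a))).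
apply: (@directed_acyclic_of_rank (io_graph ty) r) => a.
exact: r_lt (val a).
Qed.

(** * Switching graphs as partial functions on nodes *)

Section Switching.
Variable phi : {n : nodes G | switched n} -> arcs G.
Hypothesis switch_phi : is_switching phi.
Let H := switching_graph phi.

Lemma switched_src (a : arcs G) : switched (head a) -> io_src a = head a.
Proof.
have := premise_polarity a; case: io_srcP => // Pa.
rewrite /switched /is_contraction.
by case: (lab (head a)); rewrite // (not_polarized_both Pa).
Qed.

(** The predicate carried by the arcs of [switching_graph phi], named so that arcs of that graph can
    be handled as arcs of [G]. *)
Definition kept (a : arcs G) :=
  if insub (head a) is Some m then a == phi m else true.

Lemma kept_src_unique (a b : arcs G) :
  kept a -> kept b -> io_src a = io_src b -> a = b.
Proof.
move=> Ka Kb eq_ab.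
have [lPW|] := boolP (lab (io_src a) \in [:: Lpar; Lwhy]); last exact: io_src_unique.
have ha := io_src_switch lPW; have := io_src_switch (a := b).
rewrite -eq_ab => /(_ lPW) hb; move: Ka Kb; rewrite /kept ha hb.
case: insubP => [m _ _ /eqP-> /eqP-> //|].
rewrite /switched /is_contraction => nsw _ _.
(* A par or ? node on which the switching does not act is a ? node with at most one premise. *)
have le1: #|premises (head a)| <= 1.
  rewrite ha leqNgt; apply: contra nsw => ->; rewrite andbT.
  by rewrite !inE in lPW.
by move/card_le1_eqP: le1; apply; rewrite inE // ha hb.
Qed.

(** An erased arc leaves its head, by [switched_src]. Hence only switched nodes lose outgoing arcs,
    and each of them retains the one chosen by [phi]. *)
Lemma kept_out (n : nodes G) : n \notin sinks -> exists2 a, kept a & io_src a = n.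
Proof.
move=> nsink.
have [sn|nsn] := boolP (switched n).
  have := switch_phi (Sub n sn); rewrite inE SubK => /eqP hn.
  exists (phi (Sub n sn)); last by rewrite switched_src hn.
  rewrite /kept; case: insubP => [m _ vm|]; last by rewrite hn sn.
  by apply/eqP; congr phi; apply: val_inj; rewrite vm hn SubK.
have [a /eqP Da|no_out] := pickP (fun a => io_src a == n); last first.
  by case/negP: nsink; apply/sinkP=> a; rewrite no_out.
exists a => //; rewrite /kept; case: insubP => // m sw _.
by case/negP: nsn; rewrite -Da switched_src.
Qed.

Lemma switching_cc (r : nodes G -> nat) :
  (forall a, r (io_src a) < r (io_tgt a)) ->
  acyclic H /\ #|cc H| = #|sinks|.
Proof.
move=> r_lt.
have orient (a : arcs H) := io_orient (val a).
have src_inj : injective (fun a : arcs H => io_src (val a)).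
  move=> a b eq_ab; apply/val_inj/kept_src_unique => //; exact: valP.
split; first exact: forest_acyclic orient src_inj (fun a => r_lt (val a)).
rewrite (card_cc_forest orient src_inj (fun a => r_lt (val a))).
apply: eq_card => n; rewrite inE; apply/forallP/idP => [no_out|/sinkP no_out a].
  by apply/contraT=> /kept_out[a Ka Da]; have /eqP := no_out (Sub a Ka).
exact: no_out.
Qed.

End Switching.

Lemma walk_dlink_next (H : graph) (x n : nodes H) q :
  walk (@dlink H) x q -> n \in belast x (unzip2 q) ->
  exists2 a, tail a = n & head a \in unzip2 q.
Proof.
elim: q x => [|[a y] q IHq] x //= /andP[/andP[/eqP ta /eqP ha] wq].
rewrite inE => /predU1P[->|/(IHq _ wq)[b tb hb]].
  by exists a => //; rewrite ha mem_head.
by exists b => //; rewrite inE hb orbT.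
Qed.

(* The nodes of a directed cycle form a set C in which every node has a
   successor; a switching that stays in C whenever it can yields a cycle. *)
Lemma io_acyclic_of_switchings :
  (forall phi : {n : nodes G | switched n} -> arcs G, is_switching phi ->
    acyclic (switching_graph phi)) ->
  directed_acyclic (io_graph ty).
Proof.
move=> acyc x p [[wp _ _] p_gt0 lastp].
pose C : {pred nodes G} := mem (unzip2 p).
have xC : x \in C.
  by case: p p_gt0 lastp @C {wp} => // [[a y] p] _ /= {1}<-; apply: mem_last.
have nextC n : n \in C -> exists2 a, io_src a = n & io_tgt a \in C.
  move=> nC; have [] := @walk_dlink_next _ x n p wp; last by move=> a; exists (val a).
  have: n \in x :: unzip2 p by rewrite inE [n \in _]nC orbT.
  rewrite lastI mem_rcons lastp inE => /predU1P[->|//].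
  by case: p p_gt0 {lastp C wp xC nC} => // [[a y] p] _; apply: mem_head.
have [a0 _ _] := nextC x xC.
(* A node with no arc into [C] gets an arbitrary premise. The default [a0] is never reached, because
   a switched node has a premise. *)
pose phi (m : {n : nodes G | switched n}) :=
  if [pick a | (io_src a == val m) && (io_tgt a \in C)] is Some a then a
  else odflt a0 [pick a | head a == val m].
have switch_phi : is_switching phi.
  move=> [m sm]; rewrite inE /phi /=; case: pickP => [a /andP[/eqP sa _]|_].
    rewrite io_src_switch sa //; move: sm; rewrite /switched /is_contraction.
    by rewrite !inE => /orP[->|/andP[->]]; rewrite ?orbT.
  case: pickP => [a //|no_prem].
  have [|a ha] := @premise_of m; last by have /= := no_prem a; rewrite ha eqxx.
  move: sm (arityG m); rewrite /switched /is_contraction.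
  by case/orP=> [/eqP->/andP[/eqP->]|/andP[_ /ltnW->]].
have [|r r_lt] := rank_of_acyclic
  (src := fun a : arcs (switching_graph phi) => io_src (val a))
  (tgt := fun a => io_tgt (val a)) _ (acyc phi switch_phi).
  move=> a; rewrite /ulink /dlink.
  by have [[-> ->]|[-> ->]] := io_orient (val a); rewrite /= !eqxx ?orbT.
(* At a node of [C] of maximal rank, a kept arc that stays in [C] is contradictory; the remaining
   work is to produce it. *)
have [n nC n_max] := @arg_maxnP _ x C r xC.
have [a sa tC] := nextC n nC.
suff [b Kb [sb tb]] : exists2 b, kept phi b & io_src b = n /\ io_tgt b \in C.
  by have := r_lt (Sub b Kb); rewrite SubK sb ltnNge; case/negP; apply: n_max.
have [sn|nsn] := boolP (switched n); last first.
  exists a => //; rewrite /kept; case: insubP => // m sw _.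
  by rewrite -sa switched_src // sw in nsn.
exists (phi (Sub n sn)); last first.
  rewrite /phi SubK; case: pickP => [b /andP[/eqP-> ->] //|/(_ a)].
  by rewrite sa tC eqxx.
have := switch_phi (Sub n sn); rewrite inE SubK => /eqP hn.
rewrite /kept; case: insubP => [m _ vm|]; last by rewrite hn sn.
by apply/eqP; congr phi; apply: val_inj; rewrite vm hn SubK.
Qed.

Lemma exists_switching :
  exists phi : {n : nodes G | switched n} -> arcs G, is_switching phi.
Proof.
have prem (m : {n : nodes G | switched n}) : exists a : arcs G, head a == val m.
  have [|a <-] := @premise_of (val m); last by exists a.
  move: (valP m) (arityG (val m)); rewrite /switched /is_contraction.
  by case/orP=> [/eqP->/andP[/eqP->]|/andP[_ /ltnW->]].
exists (fun m => xchoose (prem m)) => m.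
by rewrite inE (xchooseP (prem m)).
Qed.

(** From left to right, acyclicity draws on all switchings, while the count is read off a single
    one, supplied by [exists_switching]. *)
Lemma ground_ACC_w_io : ground_ACC_w G <-> ground_ACC_io ty.
Proof.
split=> [accw|[/io_directed_acyclicP[r r_lt] out1] phi switch_phi].
  have acyc : directed_acyclic (io_graph ty).
    by apply: io_acyclic_of_switchings => phi /accw[].
  split=> //; have /io_directed_acyclicP[r r_lt] := acyc.
  have [phi switch_phi] := exists_switching.
  have [_] := switching_cc switch_phi r_lt; have [_ ->] := accw _ switch_phi.
  by rewrite card_sinks => /addnI.
have [acyc ->] := switching_cc switch_phi r_lt.
by rewrite card_sinks out1.
Qed.

End Polarized.

(** * Representing parts of a ground-structure *)

Lemma map_permute (T U : Type) (h : T -> U) (s : seq T) sigma :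
  map h (permute s sigma) = permute (map h s) sigma.
Proof.
elim: sigma => //= i sigma IHsigma; rewrite /permute /= onth_map.
by case: (onth s i) => [x|] //=; congr cons.
Qed.

Lemma permute_of_perm (T : eqType) (c d : seq T) : uniq c -> perm_eq d c ->
  exists2 sigma, perm_eq sigma (iota 0 (size c)) & permute c sigma = d.
Proof.
move=> Uc pdc; exists (map (index^~ c) d).
  have -> : iota 0 (size c) = map (index^~ c) c.
    case: c Uc {pdc} => // x c Uc; apply: (@eq_from_nth _ 0) => [|i].
      by rewrite size_map size_iota.
    rewrite size_iota => lt_i.
    by rewrite nth_iota // (nth_map x) // index_uniq.
  exact: perm_map.
have: {subset d <= c} by move=> x; rewrite (perm_mem pdc).
elim: d {pdc} => //= x d IHd sub.
have xc : x \in c by apply: sub; rewrite mem_head.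
rewrite /permute /=.
have -> : onth c (index x c) = Some x.
  by rewrite onthE (nth_map x) ?nth_index // index_mem.
by congr cons; apply: IHd => y yd; apply: sub; rewrite inE yd orbT.
Qed.

Lemma relocateP (R : proof_structure) (s : seq (arcs (ground_of R))) (K : finType)
    (n : nodes (ground_of R)) :
  (n \in map (@head _) s /\ relocate s K n = inr None) \/
  (exists2 k : kept_node s, val k = n & relocate s K n = inl k).
Proof.
rewrite /relocate; case: insubP => [k _ vk|]; first by right; exists k.
by rewrite negbK => ms; left.
Qed.

Section Embedding.
Variables (G : ground) (ty : arcs G -> formula).
Variable box : forall n : nodes G, is_bang (lab n) -> proof_structure.

(* [R'] is the part of the structure spanned by the nodes in [S], with the arcs
   leaving [S] ending in fresh conclusion nodes; [f] maps such a conclusion node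
   to the node outside [S] where the arc ends. *)
Record embedding (S : {set nodes G}) (c : seq (arcs G)) (R' : proof_structure)
    (f : nodes (ground_of R') -> nodes G) (g : arcs (ground_of R') -> arcs G) :
    Prop := Embedding {
  emb_tail : forall a, tail (g a) = f (tail a);
  emb_head : forall a, head (g a) = f (head a);
  emb_inj : injective g;
  emb_codom : forall a, tail a \in S -> exists a', g a' = a;
  emb_tail_in : forall a', tail (g a') \in S;
  emb_conc : forall n', (lab n' == Lconc) = (f n' \notin S);
  emb_node_inj : {in [pred n' | f n' \in S] &, injective f};
  emb_node_codom : forall n, n \in S -> exists n', f n' = n;
  emb_lab : forall n', f n' \in S -> lab (f n') = lab n';
  emb_prem : forall n', f n' \notin S ->
    exists2 a, head a = n' & forall b, head b = n' -> b = a;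
  emb_concls : map g (concls_of R') = c;
  emb_bang : forall n', f n' \in S -> lab n' = Lbang ->
    bang_concls (f n') = map g (bang_concls n');
  emb_prems : forall n', f n' \in S -> lab n' \in [:: Ltens; Lpar] ->
    prems (f n') = map g (prems n');
  emb_ty : forall a, ty (g a) = type_of a;
  emb_box : forall n' h h', f n' \in S ->
    ps_equal (@box (f n') h) (@box_of R' n' h') }.

Definition represents S c R' := exists f g, @embedding S c R' f g.

Lemma represents_empty : represents set0 [::] ps_empty.
Proof.
exists (fun n : void => match n with end), (fun a : void => match a with end).
by split=> // x; rewrite ?inE //; case: x.
Qed.

Lemma represents_exchange S c R' sigma :
  represents S c R' -> represents S (permute c sigma) (ps_exchange R' sigma).
Proof.
case: R' => G' ty' box' [f [g [h1 h2 h3 h4 h5 h6 h7 h8 h9 h10 h11 h12 h13 h14 h15]]].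
exists f, g; split=> //.
by rewrite -h11 map_permute.
Qed.

(** No arc may join the two parts: it would end in a conclusion node of one component of the union,
    whereas it is internal to [S1 :|: S2]. Under this condition the two embeddings are simply
    juxtaposed. *)
Lemma represents_union (S1 S2 : {set nodes G}) c1 c2 R1 R2 :
  [disjoint S1 & S2] ->
  (forall a : arcs G, tail a \in S1 -> head a \notin S2) ->
  (forall a : arcs G, tail a \in S2 -> head a \notin S1) ->
  represents S1 c1 R1 -> represents S2 c2 R2 ->
  represents (S1 :|: S2) (c1 ++ c2) (ps_union R1 R2).
Proof.
move=> dis out1 out2 [f1 [g1 E1]] [f2 [g2 E2]].
have dis12 n : n \in S1 -> n \in S2 -> False.
  by move=> n1 n2; move/pred0P: dis => /(_ n) /=; rewrite n1 n2.
have f1S2 n : f1 n \notin S2.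
  apply/negP=> fn2; have [fn1|nfn1] := boolP (f1 n \in S1).
    exact: dis12 fn1 fn2.
  have [a ha _] := emb_prem E1 nfn1.
  by have := out1 _ (emb_tail_in E1 a); rewrite (emb_head E1) ha fn2.
have f2S1 n : f2 n \notin S1.
  apply/negP=> fn1; have [fn2|nfn2] := boolP (f2 n \in S2).
    exact: dis12 fn1 fn2.
  have [a ha _] := emb_prem E2 nfn2.
  by have := out2 _ (emb_tail_in E2 a); rewrite (emb_head E2) ha fn1.
have f1U n : (f1 n \in S1 :|: S2) = (f1 n \in S1).
  by rewrite inE (negPf (f1S2 n)) orbF.
have f2U n : (f2 n \in S1 :|: S2) = (f2 n \in S2).
  by rewrite inE (negPf (f2S1 n)).
exists (fun n : nodes (ground_of (ps_union R1 R2)) =>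
  match n with inl n => f1 n | inr n => f2 n end).
exists (fun a : arcs (ground_of (ps_union R1 R2)) =>
  match a with inl a => g1 a | inr a => g2 a end).
split.
- by case=> a; [exact: (emb_tail E1)|exact: (emb_tail E2)].
- by case=> a; [exact: (emb_head E1)|exact: (emb_head E2)].
- move=> [] a [] b.
  + by move/(emb_inj E1)->.
  + move=> eq_ab; case: (dis12 (tail (g1 a))); first exact: (emb_tail_in E1).
    by rewrite eq_ab; apply: (emb_tail_in E2).
  + move=> eq_ab; case: (dis12 (tail (g2 a))); last exact: (emb_tail_in E2).
    by rewrite eq_ab; apply: (emb_tail_in E1).
  + by move/(emb_inj E2)->.
- move=> a; rewrite inE => /orP[/(emb_codom E1)|/(emb_codom E2)] [a' <-].
    by exists (inl a').
  by exists (inr a').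
- by case=> a; rewrite inE ?(emb_tail_in E1) // (emb_tail_in E2) orbT.
- by case=> n; rewrite ?f1U ?f2U; [exact: (emb_conc E1)|exact: (emb_conc E2)].
- move=> [] m [] n; rewrite !inE ?(negPf (f1S2 _)) ?(negPf (f2S1 _)) ?orbF /=
    => Hm Hn eq_f.
  + by rewrite (emb_node_inj E1 Hm Hn eq_f).
  + by case: (dis12 _ Hm); rewrite eq_f.
  + by case: (dis12 _ Hn); rewrite -eq_f.
  + by rewrite (emb_node_inj E2 Hm Hn eq_f).
- move=> n; rewrite inE => /orP[/(emb_node_codom E1)|/(emb_node_codom E2)] [m <-].
    by exists (inl m).
  by exists (inr m).
- by case=> n; rewrite ?f1U ?f2U; [exact: (emb_lab E1)|exact: (emb_lab E2)].
- case=> n; rewrite ?f1U ?f2U.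
    move/(emb_prem E1)=> [a ha ua]; exists (inl a); first by rewrite /= ha.
    by case=> b //= [/ua->].
  move/(emb_prem E2)=> [a ha ua]; exists (inr a); first by rewrite /= ha.
  by case=> b //= [/ua->].
- by rewrite /concls_of /= map_cat -!map_comp -(emb_concls E1) -(emb_concls E2).
- case=> n; rewrite ?f1U ?f2U => Sn ln /=; rewrite -map_comp.
    exact: (emb_bang E1).
  exact: (emb_bang E2).
- case=> n; rewrite ?f1U ?f2U => Sn ln /=; rewrite -map_comp.
    exact: (emb_prems E1).
  exact: (emb_prems E2).
- by case=> a; [exact: (emb_ty E1)|exact: (emb_ty E2)].
- case=> n h h'; rewrite ?f1U ?f2U => Sn.
    exact: (emb_box E1).
  exact: (emb_box E2).
Qed.

(** The common core of the logical rules: [add_node] enlarges the represented part by [n]. The list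
    [s] must contain every arc of [R'] ending at [n], so that no surviving conclusion node still
    stands for [n]. The conclusions of [n] must leave [n |: S], since each of them is given a fresh
    conclusion node. *)
Lemma embedding_add (S : {set nodes G}) c0 R' f g (n : nodes G)
    (s : seq (arcs (ground_of R'))) l (b : is_bang l -> proof_structure)
    (K : finType) (tyK : K -> formula) (gK : K -> arcs G)
    (c : seq (arcs (ground_of R') + K)) :
  @embedding S c0 R' f g -> n \notin S -> lab n = l -> l != Lconc ->
  (forall a, (a \in s) = (head (g a) == n)) ->
  injective gK -> (forall a, tail a = n -> exists k, gK k = a) ->
  (forall k, tail (gK k) = n) -> (forall k, head (gK k) \notin n |: S) ->
  (forall k, ty (gK k) = tyK k) ->
  (l = Lbang -> bang_concls n = map gK (enum K)) ->
  (l \in [:: Ltens; Lpar] -> prems n = map g s) ->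
  (forall h h', ps_equal (@box n h) (b h')) ->
  represents (n |: S) (map (fun a => match a with inl a => g a | inr k => gK k end) c)
    (add_node s b tyK c).
Proof.
move=> E nS ln lconc mem_s injK ontoK tailK headK tyKE bangK premsK boxK.
have kept_S (m : nodes (ground_of R')) : f m \in S -> m \notin map (@head _) s.
  move=> fmS; apply/mapP=> -[a]; rewrite mem_s => /eqP ha eq_m.
  by move: fmS; rewrite eq_m -(emb_head E) ha (negPf nS).
have f_kept (k : kept_node s) : f (val k) != n.
  apply/eqP=> fk; have [a ha _] : exists2 a, head a = val k &
    forall b, head b = val k -> b = a by apply: (emb_prem E); rewrite fk.
  have := valP k; rewrite -ha map_f // mem_s (emb_head E) ha fk.
  exact: eqxx.
have fU (k : kept_node s) : (f (val k) \in n |: S) = (f (val k) \in S).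
  by rewrite !inE (negPf (f_kept k)).
pose f' (m : nodes (ground_of (add_node s b tyK c))) :=
  match m with inl m => f (val m) | inr None => n | inr (Some k) => head (gK k) end.
have headNS k : head (gK k) \in n |: S -> False by rewrite (negPf (headK k)).
exists f', (fun a : arcs (ground_of (add_node s b tyK c)) =>
  match a with inl a => g a | inr k => gK k end).
split.
- case=> a /=; last exact: tailK.
  have: f (tail a) \in S by rewrite -(emb_tail E) (emb_tail_in E).
  case: (relocateP s K (tail a)) => [[ta _]|[k vk ->] _]; last first.
    by rewrite /f' vk (emb_tail E).
  by move/kept_S; rewrite ta.
- case=> a //=; case: (relocateP s K (head a)) => [[/mapP[d ds hd] ->]|[k vk ->]] /=.
    by rewrite (emb_head E) hd -(emb_head E); apply/eqP; rewrite -mem_s.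
  by rewrite vk (emb_head E).
- move=> [] a [] k.
  + by move/(emb_inj E)->.
  + by move=> eq_a; have := emb_tail_in E a; rewrite eq_a tailK (negPf nS).
  + by move=> eq_a; have := emb_tail_in E k; rewrite -eq_a tailK (negPf nS).
  + by move/injK->.
- move=> a; rewrite !inE => /orP[/eqP/ontoK[k <-]|/(emb_codom E)[a' <-]].
    by exists (inr k).
  by exists (inl a').
- by case=> a; rewrite !inE ?tailK ?eqxx // (emb_tail_in E) orbT.
- case=> [k|[k|]] /=.
  + by rewrite fU; apply: (emb_conc E).
  + by rewrite headK.
  + by rewrite !inE eqxx; apply/negbTE.
- have inE' m : (m \in [pred n' | f' n' \in n |: S]) = (f' m \in n |: S) by [].
  case=> [k|[k|]] [k'|[k'|]] //=; rewrite !inE' /f' ?fU;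
    try by [move/headNS|move=> _ /headNS].
  + by move=> kS kS' eq_f; congr inl; apply/val_inj/(emb_node_inj E); rewrite ?inE.
  + by move=> _ _ /eqP; rewrite (negPf (f_kept k)).
  + by move=> _ _ /esym/eqP; rewrite (negPf (f_kept k')).
- move=> m; rewrite !inE => /predU1P[->|mS]; first by exists (inr None).
  have [m' fm'] := emb_node_codom E mS.
  have km : m' \notin map (@head _) s by rewrite kept_S ?fm'.
  by exists (inl (Sub m' km)); rewrite /f' SubK.
- case=> [k|[k|]] //=; first by rewrite fU => /(emb_lab E).
  by move/headNS.
- case=> [k|[k|]] /=.
  + rewrite fU => /(emb_prem E)[a ha ua]; exists (inl a) => /=.
      case: (relocateP s K (head a)) => [[]|[k' vk ->]].
        by rewrite ha (negPf (valP k)).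
      by congr inl; apply: val_inj; rewrite vk ha.
    case=> d //=; case: (relocateP s K (head d)) => [[_ ->]|[k' vk -> [eq_k]]] //.
    by congr inl; apply: ua; rewrite -vk eq_k.
  + move=> _; exists (inr k) => // -[d|k' [->]] //=.
    by case: (relocateP s K (head d)) => [[_ ->]|[k' vk ->]].
  + by rewrite !inE eqxx.
- by [].
- case=> [k|[k|]] //=.
  + by rewrite fU -map_comp; apply: (emb_bang E).
  + by move=> _ /bangK->; rewrite -map_comp.
- case=> [k|[k|]] //=.
  + by rewrite fU -map_comp; apply: (emb_prems E).
  + by move=> _ /premsK->; rewrite -map_comp.
- by case=> a //=; apply: (emb_ty E).
- case=> [k|[k|]] h h' //=.
  by rewrite fU; apply: (emb_box E).
Qed.

(** Every tail lies in the represented set, so [g] is onto; a conclusion node is determined by its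
    only premise, so [f] is injective outside that set too. The inverses of [f] and [g] form the
    required renaming. *)
Lemma represents_full R' :
  is_ground_structure G -> represents [set n | lab n != Lconc] (concls G) R' ->
  ps_equal (PS ty box) R'.
Proof.
case=> arityG _ _ _; case: R' => G' ty' box' [f [g E]].
set S := [set n | _] in E.
have tail_in (a : arcs G) : tail a \in S.
  rewrite inE; apply/eqP=> ta; have := arityG (tail a).
  rewrite ta => /andP[_]; apply/negP; rewrite -lt0n.
  by apply/card_gt0P; exists a; rewrite inE.
have g_onto a : exists a', g a' == a.
  by have [a' <-] := emb_codom E (tail_in a); exists a'.
have f_onto n : exists n', f n' == n.
  have [nS|nS] := boolP (n \in S).
    by have [n' <-] := emb_node_codom E nS; exists n'.
  have ln : lab n = Lconc by move: nS; rewrite inE negbK => /eqP.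
  have := arityG n; rewrite ln => /andP[/eqP p1 _].
  have /card_gt0P[a] : 0 < #|premises n| by rewrite p1.
  rewrite inE => /eqP <-; have [a' /eqP<-] := g_onto a.
  by exists (head a'); rewrite (emb_head E).
have f_inj : injective f.
  move=> m n eq_f; have [nS|nS] := boolP (f n \in S).
    have mS : f m \in S by rewrite eq_f.
    exact: (emb_node_inj E mS nS eq_f).
  have mS : f m \notin S by rewrite eq_f.
  have [a ha _] := emb_prem E mS; have [b hb _] := emb_prem E nS.
  rewrite -ha -hb; congr head; apply: (emb_inj E).
  have ln : lab (f n) = Lconc by move: nS; rewrite inE negbK => /eqP.
  have := arityG (f n); rewrite ln => /andP[/eqP p1 _].
  have /card_le1_eqP: #|premises (f n)| <= 1 by rewrite p1.
  by apply; rewrite inE (emb_head E) ?ha ?hb ?eq_f.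
pose F n := xchoose (f_onto n); pose Gg a := xchoose (g_onto a).
have FK : cancel F f by move=> n; apply/eqP/(xchooseP (f_onto n)).
have fK : cancel f F by move=> n; apply: f_inj; rewrite FK.
have GK : cancel Gg g by move=> a; apply/eqP/(xchooseP (g_onto a)).
have gK : cancel g Gg by move=> a; apply: (emb_inj E); rewrite GK.
have labF n : lab (F n) = lab n.
  have [nS|nS] := boolP (n \in S).
    by rewrite -{2}(FK n) (emb_lab E) // FK.
  transitivity Lconc; first by apply/eqP; rewrite (emb_conc E) FK.
  by move: nS; rewrite inE negbK => /eqP->.
have in_S n l : l != Lconc -> lab n = l -> n \in S by rewrite inE => ? ->.
exists F, Gg; split; first split.
- by split; [exists f|exists g].
- by split=> a; apply: f_inj; rewrite FK -(emb_tail E, emb_head E) GK.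
- exact: labF.
- by rewrite -(emb_concls E) (mapK gK).
- split=> n ln.
    have nS : n \in S by apply: in_S ln.
    by rewrite -{2}(FK n) (emb_bang E) ?FK ?labF // (mapK gK).
  have nS : n \in S by apply: (in_S _ (lab n)) => //; case: (lab n) ln.
  by rewrite -{2}(FK n) (emb_prems E) ?FK ?labF // (mapK gK).
- by move=> a; rewrite -[in RHS](GK a) (emb_ty E).
- move=> n h h'; have nS : n \in S by rewrite inE; case: (lab n) h.
  (* The type of [h'] mentions [F n]. Generalizing [F n] to [m] allows [n] to be replaced by [f m],
     the form in which boxes are compared by the embedding. *)
  have eq_n := FK n; move: (F n) h' eq_n => m h' eq_n.
  by subst n; apply: (emb_box E).
Qed.

End Embedding.

(** * Sequent calculus rules acting on parts of a ground-structure *)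

Section Rules.
Variables (G : ground) (ty : arcs G -> formula).
Variable box : forall n : nodes G, is_bang (lab n) -> proof_structure.
Hypothesis groundG : is_ground_structure G.
Hypothesis polG : forall a, MELLpol (ty a).
Hypothesis typedG : forall n, node_typed ty n.

Let arityG (n : nodes G) : arity (lab n) #|premises n| #|conclusions n|.
Proof. by case: groundG. Qed.

Local Notation represents := (represents ty box).

(** The sequent is tied to [c] by an equation because [proof] is indexed by it: each rule can
    rewrite it into the shape that its constructor expects. *)
Definition derivable (S : {set nodes G}) (c : seq (arcs G)) : Prop :=
  exists (Gamma : seq formula) (pi : proof Gamma),
    [/\ proof_in MELLpol pi, Gamma = map ty c & represents S c (deseq pi)].

Let all_pol c : all MELLpol (map ty c).
Proof. by rewrite all_map; apply/allP=> a _; apply: polG. Qed.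

Lemma rule_exchange S c d : derivable S c -> uniq c -> perm_eq d c -> derivable S d.
Proof.
case=> Gamma [pi [pin eqG rep]] Uc /(permute_of_perm Uc)[sigma psigma <-].
have psigma' : perm_eq sigma (iota 0 (size Gamma)) by rewrite eqG size_map.
exists _, (p_exch psigma' pi); split.
- by rewrite /= pin eqG -map_permute all_pol.
- by rewrite eqG map_permute.
- exact: represents_exchange.
Qed.

(** The conclusions of [R1] are cut into an abstract [k ++ s] to cover both shapes found in [deseq]:
    the bottom rule keeps the whole list, the other unary rules take and drop at the size of the
    context. *)
Lemma represents_unary (S : {set nodes G}) c ps R1 k s (n : nodes G) (d : arcs G) l
    (b : is_bang l -> proof_structure) T :
  represents S (c ++ ps) R1 -> concls_of R1 = k ++ s -> size k = size c ->
  n \notin S -> lab n = l -> l != Lconc -> is_bang l = false ->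
  ps =i premises n -> (l \in [:: Ltens; Lpar] -> prems n = ps) ->
  tail d = n -> #|conclusions n| = 1 -> head d \notin n |: S -> ty d = T ->
  represents (n |: S) (c ++ [:: d])
    (add_node (R := R1) s b (fun _ : unit => T) (map inl k ++ [:: inr tt])).
Proof.
move=> [f [g E]] eqc szk nS ln lconc lbang mem_ps prems_ps td c1 hd tyd.
have := emb_concls E; rewrite eqc map_cat => /eqP.
rewrite eqseq_cat ?size_map // => /andP[/eqP gk /eqP gs].
have -> : c ++ [:: d] = map (fun a => match a with inl a => g a | inr _ => d end)
    (map inl k ++ [:: inr tt]) by rewrite map_cat -map_comp -gk.
apply: (embedding_add (gK := fun _ : unit => d) _ E nS ln lconc) => //.
- by move=> a; rewrite -(mem_map (emb_inj E)) gs mem_ps inE.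
- by case=> -[].
- move=> a ta; exists tt; apply: conclusion_unique; last by rewrite ta.
  by rewrite td.
- by move=> lb; rewrite lb in lbang.
- by move/prems_ps->.
- by move=> h h'; exfalso; move: h'; rewrite lbang.
Qed.

Lemma represents_size S c R1 : represents S c R1 -> size (concls_of R1) = size c.
Proof. by case=> f [g E]; rewrite -(emb_concls E) size_map. Qed.

Lemma represents_unary_drop (S : {set nodes G}) c ps R1 (n : nodes G) (d : arcs G) l
    (b : is_bang l -> proof_structure) T :
  represents S (c ++ ps) R1 ->
  n \notin S -> lab n = l -> l != Lconc -> is_bang l = false ->
  ps =i premises n -> (l \in [:: Ltens; Lpar] -> prems n = ps) ->
  tail d = n -> #|conclusions n| = 1 -> head d \notin n |: S -> ty d = T ->
  represents (n |: S) (c ++ [:: d])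
    (add_node (R := R1) (drop (size (map ty c)) (concls_of R1)) b (fun _ : unit => T)
       (map inl (take (size (map ty c)) (concls_of R1)) ++ [:: inr tt])).
Proof.
move=> rep; rewrite size_map => nS ln lconc lbang mem_ps prems_ps td c1 hd tyd.
apply: (represents_unary _ rep _ _ nS ln lconc lbang mem_ps prems_ps td c1 hd tyd).
  by rewrite cat_take_drop.
by rewrite size_take (represents_size rep) size_cat; case: ltnP; lia.
Qed.

Lemma rule_bot (S : {set nodes G}) c (n : nodes G) (d : arcs G) :
  lab n = Lbot -> tail d = n -> n \notin S -> head d \notin n |: S ->
  derivable S c -> derivable (n |: S) (c ++ [:: d]).
Proof.
move=> ln td nS hd [Gamma [pi [pin eqG rep]]].
have := arityG n; rewrite ln => /andP[/eqP p0 /eqP c1].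
have tyd : ty d = Bot by have := typedG n; rewrite /node_typed ln; apply.
exists _, (p_bot pi); split.
- by rewrite /= pin andbT eqG -tyd; have := all_pol (c ++ [:: d]); rewrite map_cat.
- by rewrite eqG map_cat /= tyd.
- apply: (represents_unary (ps := [::])) => //; rewrite ?cats0 ?(represents_size rep) //.
  by move=> a; rewrite (cards0_eq p0) !inE.
Qed.

Lemma rule_par (S : {set nodes G}) c (n : nodes G) (d : arcs G) :
  lab n = Lpar -> tail d = n -> n \notin S -> head d \notin n |: S ->
  derivable S (c ++ prems n) -> derivable (n |: S) (c ++ [:: d]).
Proof.
move=> ln td nS hd [Gamma [pi [pin eqG rep]]].
have := arityG n; rewrite ln => /andP[/eqP p2 /eqP c1].
have [A [B [eqAB tyd]]] : exists A B,
    [seq ty a | a <- prems n] = [:: A; B] /\ ty d = Par A B.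
  by have := typedG n; rewrite /node_typed ln; apply.
rewrite map_cat eqAB in eqG; move: pi pin rep; rewrite eqG => pi pin rep.
exists _, (p_par pi); split.
- by rewrite /= pin andbT -tyd; have := all_pol (c ++ [:: d]); rewrite map_cat.
- by rewrite map_cat /= tyd.
- apply: (represents_unary_drop _ rep) => //.
  by case: groundG => _ _ _; case/(_ n); rewrite ?ln.
Qed.

Lemma rule_der (S : {set nodes G}) c (n : nodes G) (a d : arcs G) :
  lab n = Lder -> head a = n -> tail d = n -> n \notin S -> head d \notin n |: S ->
  derivable S (c ++ [:: a]) -> derivable (n |: S) (c ++ [:: d]).
Proof.
move=> ln ha td nS hd [Gamma [pi [pin eqG rep]]].
have := arityG n; rewrite ln => /andP[/eqP p1 /eqP c1].
have tyd : ty d = WhyNot (ty a).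
  by have := typedG n; rewrite /node_typed ln; apply.
rewrite map_cat in eqG; move: pi pin rep; rewrite eqG => pi pin rep.
exists _, (p_der pi); split.
- by rewrite /= pin andbT -tyd; have := all_pol (c ++ [:: d]); rewrite map_cat.
- by rewrite map_cat /= tyd.
- apply: (represents_unary_drop _ rep) => // e.
  rewrite !inE; apply/eqP/eqP=> [->//|he]; apply: premise_unique; rewrite ?he //.
Qed.

Lemma rule_why (S : {set nodes G}) c (n : nodes G) (d : arcs G) :
  lab n = Lwhy -> tail d = n -> n \notin S -> head d \notin n |: S ->
  derivable S (c ++ enum (premises n)) -> derivable (n |: S) (c ++ [:: d]).
Proof.
move=> ln td nS hd [Gamma [pi [pin eqG rep]]].
have := arityG n; rewrite ln => /eqP c1.
have [A tyA] : exists A, forall a, head a = n \/ tail a = n -> ty a = WhyNot A.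
  by have := typedG n; rewrite /node_typed ln.
have tyd : ty d = WhyNot A by apply: tyA; right.
have eqA : map ty (enum (premises n)) = nseq #|premises n| (WhyNot A).
  have: {in enum (premises n), forall a, ty a = WhyNot A}.
    by move=> a; rewrite mem_enum inE => /eqP ha; apply: tyA; left.
  by rewrite cardE; elim: (enum _) => //= a s IHs tys; rewrite tys ?mem_head //
     IHs // => e es; apply: tys; rewrite inE es orbT.
rewrite map_cat eqA in eqG; move: pi pin rep; rewrite eqG => pi pin rep.
exists _, (p_why pi); split.
- by rewrite /= pin andbT -tyd; have := all_pol (c ++ [:: d]); rewrite map_cat.
- by rewrite map_cat /= tyd.
- apply: (represents_unary_drop _ rep) => // e.
  by rewrite mem_enum.
Qed.

Lemma embedding_binary (S1 S2 : {set nodes G}) c1 c2 a1 a2 R1 R2 :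
  [disjoint S1 & S2] ->
  (forall a : arcs G, tail a \in S1 -> head a \notin S2) ->
  (forall a : arcs G, tail a \in S2 -> head a \notin S1) ->
  represents S1 (c1 ++ [:: a1]) R1 -> represents S2 (a2 :: c2) R2 ->
  let d1 := map inl (concls_of R1) in
  let d2 := map inr (concls_of R2) in
  exists f g, [/\ @embedding G ty box (S1 :|: S2) ((c1 ++ [:: a1]) ++ (a2 :: c2))
                     (ps_union R1 R2) f g,
      map g (take (size (map ty c1)) d1) = c1,
      map g (drop (size (map ty c1)) d1 ++ take 1 d2) = [:: a1; a2]
    & map g (drop 1 d2) = c2].
Proof.
move=> dis out1 out2 rep1 rep2 d1 d2.
have [f [g E]] := represents_union dis out1 out2 rep1 rep2.
have := emb_concls E; rewrite /concls_of /= map_cat => /eqP.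
rewrite eqseq_cat; last by rewrite !size_map -(represents_size rep1).
case/andP=> /eqP g1 /eqP g2; exists f, g; split=> //.
- by rewrite map_take g1 size_map take_size_cat.
- by rewrite map_cat map_drop map_take g1 g2 size_map drop_size_cat //= take0.
- by rewrite map_drop g2 /= drop0.
Qed.

Lemma rule_cut (S1 S2 : {set nodes G}) c1 c2 (n : nodes G) (a b : arcs G) :
  lab n = Lcut -> head a = n -> head b = n -> a <> b ->
  n \notin S1 :|: S2 -> [disjoint S1 & S2] ->
  (forall a : arcs G, tail a \in S1 -> head a \notin S2) ->
  (forall a : arcs G, tail a \in S2 -> head a \notin S1) ->
  derivable S1 (c1 ++ [:: a]) -> derivable S2 (b :: c2) ->
  derivable (n |: (S1 :|: S2)) (c1 ++ c2).
Proof.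
move=> ln ha hb ab nS dis out1 out2.
move=> [Gamma1 [pi1 [pin1 eqG1 rep1]]] [Gamma2 [pi2 [pin2 eqG2 rep2]]].
have := arityG n; rewrite ln => /andP[/eqP p2 /eqP c0].
have tyb : ty b = dual (ty a) by have := typedG n; rewrite /node_typed ln; apply.
rewrite map_cat in eqG1; move: pi1 pin1 rep1; rewrite {}eqG1 => pi1 pin1 rep1.
rewrite /= tyb in eqG2; move: pi2 pin2 rep2; rewrite {}eqG2 => pi2 pin2 rep2.
exists _, (p_cut pi1 pi2); split; rewrite -?map_cat //.
  by rewrite /= pin1 pin2 -map_cat all_pol.
have [f [g [E g1 gs g2]]] := embedding_binary dis out1 out2 rep1 rep2.
set s := drop _ _ ++ _ in gs.
pose gK (v : void) : arcs G := match v with end.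
have -> : c1 ++ c2 = map (fun a => match a with inl a => g a | inr k => gK k end)
    (map inl (take (size (map ty c1)) (map inl (concls_of (deseq pi1))) ++
              drop 1 (map inr (concls_of (deseq pi2))))).
  by rewrite -map_comp map_cat g1 g2.
have ps_eq x : (x \in [:: a; b]) = (head x == n).
  have := set2_of_card p2 _ _ (introN eqP ab); rewrite !inE ha hb eqxx.
  by move=> /(_ isT isT)/setP/(_ x); rewrite !inE => ->.
apply: (@embedding_add _ _ _ _ _ (ps_union _ _) _ _ _ s
  Lcut nobox void _ gK _ E nS ln isT) => //; try by case.
- by move=> x; rewrite -(mem_map (emb_inj E)) gs ps_eq.
- move=> x tx; have: x \in conclusions n by rewrite inE tx.
  by rewrite (cards0_eq c0) inE.
Qed.

Lemma rule_tens (S1 S2 : {set nodes G}) c1 c2 (n : nodes G) (a b d : arcs G) :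
  lab n = Ltens -> prems n = [:: a; b] -> tail d = n ->
  n \notin S1 :|: S2 -> head d \notin n |: (S1 :|: S2) -> [disjoint S1 & S2] ->
  (forall a : arcs G, tail a \in S1 -> head a \notin S2) ->
  (forall a : arcs G, tail a \in S2 -> head a \notin S1) ->
  derivable S1 (c1 ++ [:: a]) -> derivable S2 (b :: c2) ->
  derivable (n |: (S1 :|: S2)) (c1 ++ d :: c2).
Proof.
move=> ln eq_prems td nS hd dis out1 out2.
move=> [Gamma1 [pi1 [pin1 eqG1 rep1]]] [Gamma2 [pi2 [pin2 eqG2 rep2]]].
have := arityG n; rewrite ln => /andP[/eqP p2 /eqP cc1].
have tyd : ty d = Tens (ty a) (ty b).
  have := typedG n; rewrite /node_typed ln eq_prems => /(_ d td).
  by case=> A [B [[<- <-]]].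
rewrite map_cat in eqG1; move: pi1 pin1 rep1; rewrite {}eqG1 => pi1 pin1 rep1.
move: pi2 pin2 rep2; rewrite {}eqG2 => pi2 pin2 rep2.
exists _, (p_tens pi1 pi2); split; rewrite -?tyd -?map_cons -?map_cat //.
  by rewrite /= pin1 pin2 -tyd -map_cons -map_cat all_pol.
have [f [g [E g1 gs g2]]] := embedding_binary dis out1 out2 rep1 rep2.
set s := drop _ _ ++ _ in gs.
have -> : c1 ++ d :: c2 =
    map (fun a => match a with inl a => g a | inr _ => d end)
      (map inl (take (size (map ty c1)) (map inl (concls_of (deseq pi1)))) ++
       inr tt :: map inl (drop 1 (map inr (concls_of (deseq pi2))))).
  by rewrite map_cat /= -!map_comp g1 g2.
have ps_eq x : (x \in [:: a; b]) = (head x == n).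
  by case: groundG => _ _ _ /(_ n); rewrite ln eq_prems; case=> // _ ->; rewrite inE.
apply: (@embedding_add _ _ _ _ _ (ps_union _ _) _ _ _ s
  Ltens nobox unit _ (fun=> d) _ E nS ln isT) => //.
- by move=> x; rewrite -(mem_map (emb_inj E)) gs ps_eq.
- by case=> -[].
- by move=> x tx; exists tt; apply: conclusion_unique; rewrite ?td.
- by rewrite gs.
Qed.

Let sep_set0 (n a : nodes G) : a != n -> a \notin n |: set0.
Proof. by rewrite !inE orbF. Qed.

Lemma rule_one (n : nodes G) (d : arcs G) :
  lab n = Lone -> tail d = n -> head d != n -> derivable [set n] [:: d].
Proof.
move=> ln td hd; have := arityG n; rewrite ln => /andP[/eqP p0 /eqP c1].
have tyd : ty d = One by have := typedG n; rewrite /node_typed ln; apply.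
exists _, p_one; split=> //=; first by rewrite tyd.
have [f [g E]] := represents_empty ty box; have nS : n \notin set0 by rewrite inE.
rewrite -[[set n]]setU0.
apply: (@embedding_add _ _ _ _ _ ps_empty _ _ _ [::]
  Lone nobox unit _ (fun=> d) [:: inr tt] E nS ln isT) => //.
- by move=> [] [].
- by move=> x tx; exists tt; apply: conclusion_unique; rewrite ?td.
- by move=> _; apply: sep_set0.
Qed.

Lemma rule_ax (n : nodes G) (a b : arcs G) :
  lab n = Lax -> tail a = n -> tail b = n -> a <> b ->
  head a != n -> head b != n -> derivable [set n] [:: a; b].
Proof.
move=> ln ta tb ab ha hb; have := arityG n; rewrite ln => /andP[/eqP p0 /eqP c2].
have tyb : ty b = dual (ty a) by have := typedG n; rewrite /node_typed ln; apply.
exists _, (p_ax (ty a)); split=> /=; [|by rewrite tyb|].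
  by rewrite -tyb; have := all_pol [:: a; b]; rewrite /= andbT => ->.
have [f [g E]] := represents_empty ty box; have nS : n \notin set0 by rewrite inE.
have concls_eq x : tail x = n -> x = a \/ x = b.
  move=> tx; have := set2_of_card c2 _ _ (introN eqP ab); rewrite !inE ta tb eqxx.
  move=> /(_ isT isT)/setP/(_ x); rewrite !inE tx eqxx => /esym/orP[]/eqP;
    by [left|right].
rewrite -[[set n]]setU0.
apply: (@embedding_add _ _ _ _ _ ps_empty _ _ _ [::] Lax nobox bool _
  (fun k : bool => if k then a else b) [:: inr true; inr false] E nS ln isT) => //.
- by move=> [] [] // /esym.
- by move=> x /concls_eq[]->; [exists true|exists false].
- by case.
- by case; apply: sep_set0.
- by case; rewrite ?tyb.
Qed.

Lemma rule_bang (n : nodes G) As A (pi : proof (map WhyNot As ++ [:: A])) :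
  lab n = Lbang -> (forall a, tail a = n -> head a != n) ->
  map ty (bang_concls n) = map WhyNot As ++ [:: OfCourse A] ->
  proof_in MELLpol pi -> (forall h, ps_equal (@box n h) (deseq pi)) ->
  derivable [set n] (bang_concls n).
Proof.
move=> ln hd tyn pin boxE; exists _, (p_bang pi); split=> //.
  by rewrite /= pin andbT -tyn all_pol.
have [f [g E]] := represents_empty ty box; have nS : n \notin set0 by rewrite inE.
have [Un memn] : enumerates (bang_concls n) (conclusions n).
  by case: groundG => _ _ /(_ n ln).
set t := in_tuple (map WhyNot As ++ [:: OfCourse A]).
have szn : size t = size (bang_concls n) by rewrite -(size_map ty) tyn.
(* The list is non-empty, as its types end with [OfCourse A]; [d0] only serves as the default value
   of [nth]. *)
have [d0 d0n] : exists d0, d0 \in bang_concls n.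
  move: szn; rewrite /t /= size_cat addn1.
  by case: (bang_concls n) => // d0 s _; exists d0; apply: mem_head.
pose gK (k : 'I_(size t)) := nth d0 (bang_concls n) k.
have gK_in k : gK k \in bang_concls n by rewrite mem_nth // -szn.
have tail_gK k : tail (gK k) = n by have := gK_in k; rewrite memn inE => /eqP.
have map_gK : map gK (enum 'I_(size t)) = bang_concls n.
  by rewrite /gK (map_comp (nth d0 _) val) val_enum_ord szn -/(mkseq _ _) mkseq_nth.
rewrite -[[set n]]setU0 -{1}map_gK.
have -> : map gK (enum 'I_(size t)) =
    map (fun a => match a with inl a => g a | inr k => gK k end)
   (map inr (enum 'I_(size t))) by rewrite -[RHS]map_comp.
apply: (@embedding_add _ _ _ _ _ ps_empty _ _ _ [::]
  Lbang (fun=> deseq pi) _ _ gK _ E nS ln isT) => //.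
- move=> k k' /eqP; rewrite nth_uniq -?szn // => /eqP; exact: val_inj.
- move=> a ta; have an : a \in bang_concls n by rewrite memn inE ta.
  have lt_a : index a (bang_concls n) < size t by rewrite szn index_mem.
  by exists (Ordinal lt_a); rewrite /gK nth_index.
- by move=> k; apply/sep_set0/hd.
- move=> k; rewrite (tnth_nth (ty d0)) /=.
  transitivity (nth (ty d0) (map ty (bang_concls n)) k); last by rewrite tyn.
  by rewrite (nth_map d0) // -szn; apply: ltn_ord.
Qed.

End Rules.

(** * Sequentialization *)

Section Sequentialization.
Variables (G : ground) (ty : arcs G -> formula).
Variable box : forall n : nodes G, is_bang (lab n) -> proof_structure.
Hypothesis groundG : is_ground_structure G.
Hypothesis polG : forall a, MELLpol (ty a).
Hypothesis typedG : forall n, node_typed ty n.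
Hypothesis bangG : bang_typed ty.
Variable r : nodes G -> nat.
Hypothesis r_lt : forall a, r (io_src ty a) < r (io_tgt ty a).

Let arityG (n : nodes G) : arity (lab n) #|premises n| #|conclusions n|.
Proof. by case: groundG. Qed.

Lemma no_loop (a : arcs G) : head a != tail a.
Proof.
apply/eqP=> eq_a; have := r_lt a.
by rewrite /io_src /io_tgt eq_a; case: ifP; rewrite ltnn.
Qed.

Definition boundary (S : {set nodes G}) : {set arcs G} :=
  [set a | (tail a \in S) && (head a \notin S)].

(** Since no arc enters [S] from outside, [S] together with its outgoing arcs as conclusions behaves
    as a ground-structure of its own. *)
Definition part (S : {set nodes G}) : Prop :=
  (forall a : arcs G, head a \in S -> tail a \in S) /\
  (forall n, n \in S -> lab n != Lconc).

(** The quantity [#|d_c| + #|o_nodes|] of the structure spanned by [S], where every ?d node counts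
    because its premise is always an output. *)
Definition num_outputs (S : {set nodes G}) : nat :=
  #|[set n in S | lab n == Lder]| + #|[set a in boundary S | positive (ty a)]|.

(** For these labels all premises are outputs and at most one arc goes out, so oriented paths
    through such nodes never branch. *)
Definition simple (n : nodes G) : bool := lab n \in [:: Lax; Lone; Ltens; Lbang].

Lemma simple_premise (a : arcs G) : simple (head a) -> positive (ty a).
Proof.
have := premise_polarity groundG polG typedG a; rewrite /simple.
by case: (lab (head a)).
Qed.

Lemma simple_src_unique (a b : arcs G) :
  simple (io_src ty a) -> io_src ty a = io_src ty b -> a = b.
Proof.
move=> sa /(io_src_unique groundG polG typedG bangG); apply.
by move: sa; rewrite /simple; case: (lab _).
Qed.

(* Below every cut, the part [S] is a forest of axioms, ones, tensors and
   boxes: a node with a negative conclusion would, its conclusion not leaving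
   [S], lie above another such node. *)
Lemma simple_below S K : part S ->
  (forall a : arcs G, tail a \in S -> lab (tail a) \in [:: Lbot; Lpar; Lder; Lwhy] ->
     head a \in S) ->
  (forall n, n \in S -> lab n = Lcut -> K <= r n) ->
  forall n, n \in S -> r n < K -> simple n.
Proof.
move=> [upS concS] inner cutS n.
have [m] := ubnP (r n); elim: m n => // m IHm n lt_m nS lt_K.
have [|neg_n] := boolP (lab n \in [:: Lbot; Lpar; Lder; Lwhy]); last first.
  have := concS n nS; have := cutS n nS; rewrite /simple.
  case: (lab n) neg_n => //= _ /(_ erefl); by rewrite leqNgt lt_K.
move=> neg_n; have [c tc] : exists c, tail c = n.
  apply: conclusion_of; have := arityG n.
  by case: (lab n) neg_n => //= _; [case/andP=> _ /eqP-> | case/andP=> _ /eqP->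
     | case/andP=> _ /eqP-> | move/eqP->].
have Nc : negative (ty c).
  have := conclusion_polarity groundG polG typedG c; rewrite tc.
  by case: (lab n) neg_n.
have hcS : head c \in S by apply: inner; rewrite tc.
have lt_c : r (head c) < r n by have := r_lt c; rewrite /io_src /io_tgt Nc tc.
have : simple (head c) by apply: IHm => //; [lia|apply: ltn_trans lt_K].
by move/simple_premise; rewrite output_ninput // Nc.
Qed.

(** * Splitting a part at an output premise *)

Section Split.
Variables (S : {set nodes G}) (n : nodes G) (a b : arcs G).
Hypothesis partS : part S.
Hypothesis nS : n \in S.
Hypothesis ha : head a = n.
Hypothesis hb : head b = n.
Hypothesis ab : a <> b.
Hypothesis prem_n : forall x : arcs G, head x = n -> x = a \/ x = b.
Hypothesis Pa : positive (ty a).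
Hypothesis concl_n : forall x : arcs G, tail x = n -> head x \notin S.
Hypothesis simple_n : forall x, x \in S -> r x < r n -> simple x.

Let E : rel (nodes G) :=
  fun x y => [&& x \in S, y \in S & step (io_src ty) (io_tgt ty) x y].
Let T := [set x in S | connect E x (tail a)].
Let U := (S :\ n) :\: T.

Let src_pos x : positive (ty x) -> io_src ty x = tail x /\ io_tgt ty x = head x.
Proof. by rewrite /io_src /io_tgt; move/not_polarized_both->. Qed.

Let src_neg x : negative (ty x) -> io_src ty x = head x /\ io_tgt ty x = tail x.
Proof. by rewrite /io_src /io_tgt => ->. Qed.

Let tailaS : tail a \in S.
Proof. by case: partS => upS _; apply: upS; rewrite ha. Qed.

(** A path to [tail a] extended by the output [a] ends at [n]. This is how acyclicity enters the
    splitting: [n] is not in [T], and all of [T] falls under [simple_n]. *)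
Let T_rank x : x \in T -> r x < r n.
Proof.
rewrite inE => /andP[_ /connectP[p pp eq_p]].
have le_xa : r x <= r (tail a).
  elim: p x pp eq_p => [x _ -> //|y p IHp] x /= /andP[/and3P[_ _ xy] pp eq_p].
  apply: leq_trans (IHp _ pp eq_p); case/existsP: xy => c /andP[/eqP<- /eqP<-].
  exact/ltnW/r_lt.
apply: leq_ltn_trans le_xa _.
by have := r_lt a; case: (src_pos Pa) => -> ->; rewrite ha.
Qed.

Let T_sub x : x \in T -> x \in S.
Proof. by rewrite inE => /andP[]. Qed.

Let T_simple x : x \in T -> simple x.
Proof. by move=> xT; apply: simple_n; [apply: T_sub|apply: T_rank]. Qed.

Let tailaT : tail a \in T.
Proof. by rewrite inE tailaS connect0. Qed.

Let nT : n \notin T.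
Proof. by apply/negP=> /T_rank; rewrite ltnn. Qed.

Let T_up x : head x \in T -> positive (ty x) /\ tail x \in T.
Proof.
move=> hT; have Px := simple_premise (T_simple hT); split=> //.
have txS : tail x \in S by case: partS => upS _; apply/upS/T_sub.
rewrite inE txS; move: (hT); rewrite inE => /andP[hS]; apply: connect_trans.
apply: connect1; rewrite /E txS hS.
by case: (src_pos Px) => <- <-; apply: step_arc.
Qed.

(** The node [tail x] has a single outgoing arc. If it is [tail a], this arc is [a]; otherwise it is
    the first arc of a path to [tail a], and its target is still in [T]. *)
Let T_down x : tail x \in T -> positive (ty x) -> x = a \/ head x \in T.
Proof.
move=> tT Px; have [sx tx] := src_pos Px.
have simx : simple (io_src ty x) by rewrite sx T_simple.
move: (tT); rewrite inE => /andP[_ /connectP[[_ /= eq_t|y p /=]]].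
  left; apply: simple_src_unique => //.
  by rewrite sx -eq_t; case: (src_pos Pa).
case/andP=> /and3P[_ yS /existsP[c /andP[/eqP sc /eqP tc]]] pp eq_p.
right; have eq_c : x = c by apply: simple_src_unique => //; rewrite sc.
by rewrite -tx eq_c tc inE yS; apply/connectP; exists p.
Qed.

(** An input is oriented from its head to its tail, so a head in [S] would belong to [T]; but
    premises of nodes of [T] are outputs. *)
Let T_neg x : tail x \in T -> negative (ty x) -> head x \notin S.
Proof.
move=> tT Nx; apply/negP=> hS; have [sx tx] := src_neg Nx.
have: head x \in T.
  rewrite inE hS; move: (tT); rewrite inE => /andP[tS]; apply: connect_trans.
  by apply: connect1; rewrite /E hS tS -sx -tx step_arc.
by case/T_up => /not_polarized_both; rewrite Nx.
Qed.

Let polarity_of x : positive (ty x) \/ negative (ty x).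
Proof. by apply/orP; rewrite orbC; apply: polG. Qed.

(** Arcs entering [T] start in [T], outputs leaving [T] reduce to [a], and inputs concluding nodes
    of [T] leave [S]: nothing but [a] attaches [T] to the rest. The other premise [b] starts in [U],
    for if it started in [T] it would be [a], or [n] would be in [T] or outside [S]. *)
Lemma split_at_premise : exists T U : {set nodes G},
  [/\ S = n |: (T :|: U), n \notin T :|: U & [disjoint T & U]] /\
  [/\ part T, part U, (forall x : arcs G, tail x \in T -> head x \notin U)
    & (forall x : arcs G, tail x \in U -> head x \notin T)] /\
  [/\ forall x, x \in boundary T = (x == a) || (x \in boundary S) && (tail x \in T),
      forall x, x \in boundary U = (x == b) || (x \in boundary S) && (tail x \in U),
      (forall x, x \in boundary S -> tail x \in T -> negative (ty x))
    & (forall x, x \in T -> simple x)].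
Proof.
have [upS concS] := partS.
have U_sub x : x \in U -> x \in S by rewrite !inE; case/and3P.
have inU x : (x \in U) = [&& x \in S, x != n & x \notin T].
  by rewrite in_setD in_setD1; case: (x \in S); rewrite ?andbF //= andbT andbC.
have outT x : tail x \in T -> head x \notin U.
  move=> tT; rewrite inU; have [Px|Nx] := polarity_of x; last first.
    by rewrite (negPf (T_neg tT Nx)).
  by case: (T_down tT Px) => [->|->]; rewrite ?ha ?eqxx ?andbF.
have outU x : tail x \in U -> head x \notin T.
  by rewrite inU => /and3P[_ _]; apply: contra => /T_up[].
have bS x : x \in boundary S -> tail x \in T -> negative (ty x).
  rewrite inE => /andP[_ hS] tT; case: (polarity_of x) => // Px.
  case: (T_down tT Px) => [eq_x|/T_sub hT]; last by rewrite hT in hS.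
  by rewrite eq_x ha nS in hS.
exists T, U; do ?split => //.
- apply/setP=> x; rewrite in_setU1 in_setU inU; case: eqP => [->|_] //=.
  by have := @T_sub x; case: (x \in T) => [->//|]; rewrite andbT.
- by rewrite in_setU inU eqxx andbF orbF.
- by apply/pred0P=> x /=; rewrite inU; case: (x \in T); rewrite ?andbF.
- by move=> x /T_up[].
- by move=> x /T_sub/concS.
- move=> x hU; have := hU; rewrite !inU => /and3P[hS hn hT].
  rewrite upS //=; apply/andP; split; last by apply/negP=> /outT; rewrite hU.
  by apply/eqP=> /concl_n; rewrite hS.
- by move=> x /U_sub/concS.
- move=> x; apply/idP/idP.
    rewrite [x \in boundary T]inE => /andP[tT hT]; have [Px|Nx] := polarity_of x.
      by case: (T_down tT Px) => [->|]; rewrite ?eqxx // (negPf hT).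
    have xb : x \in boundary S by rewrite inE (T_sub tT) (T_neg tT Nx).
    by rewrite xb tT orbT.
  case/orP=> [/eqP->|]; first by rewrite [_ \in boundary T]inE tailaT ha.
  case/andP; rewrite [x \in boundary S]inE => /andP[_ hS] tT.
  by rewrite [x \in boundary T]inE tT; apply: contra hS; apply: T_sub.
- move=> x; apply/idP/idP.
    rewrite [x \in boundary U]inE => /andP[tU hU]; have: tail x \in U by [].
    rewrite {1}inU => /and3P[tS tn tT].
    have [hS|hS] := boolP (head x \in S); last first.
      by have xb : x \in boundary S by [rewrite inE tS]; rewrite xb tU orbT.
    move: hU; rewrite inU hS (outU _ tU) andbT /= negbK => /eqP/prem_n[eq_x|->].
      by move: tT; rewrite eq_x tailaT.
    by rewrite eqxx.
  case/orP=> [/eqP->|]; last first.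
    case/andP; rewrite [x \in boundary S]inE => /andP[_ hS] tU.
    by rewrite [x \in boundary U]inE tU; apply: contra hS; apply: U_sub.
  rewrite [_ \in boundary U]inE !inU hb eqxx andbF upS ?hb // -{1}hb eq_sym no_loop.
  rewrite !andbT /=; apply/negP=> tT; have [Pb|Nb] := polarity_of b.
    by case: (T_down tT Pb) => [/esym//|]; rewrite hb (negPf nT).
  by have := T_neg tT Nb; rewrite hb nS.
Qed.

End Split.

Hypothesis boxes : forall n (h : is_bang (lab n)), exists As A,
  [seq ty a | a <- bang_concls n] = map WhyNot As ++ [:: OfCourse A] /\
  exists2 pi : proof (map WhyNot As ++ [:: A]),
    proof_in MELLpol pi & ps_equal (box h) (deseq pi).

Local Notation derivable := (derivable ty box).

(** All enumerations of the boundary are allowed, since each rule wants its active conclusions at a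
    fixed place; exchange provides the reordering. *)
Definition derivable_part (S : {set nodes G}) : Prop :=
  part S -> num_outputs S = 1 ->
  forall c, uniq c -> c =i boundary S -> derivable S c.

Lemma derivable_reorder (S : {set nodes G}) c d :
  derivable S c -> uniq c -> c =i boundary S ->
  uniq d -> d =i boundary S -> derivable S d.
Proof.
move=> seq_c Uc memc Ud memd; apply: (rule_exchange polG seq_c Uc).
by apply: uniq_perm => // x; rewrite memc memd.
Qed.

Lemma conclusion_eq (a d : arcs G) :
  #|conclusions (tail d)| = 1 -> (tail a == tail d) = (a == d).
Proof.
move=> c1; apply/eqP/eqP=> [eq_t|->//].
by apply/esym/(conclusion_unique c1).
Qed.

Lemma one_conclusion (n : nodes G) : lab n \notin [:: Lax; Lcut; Lbang; Lconc] ->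
  #|conclusions n| = 1.
Proof.
by have := arityG n; case: (lab n) => //=; try case/andP; move=> *; apply/eqP.
Qed.

(** * Removing a terminal bottom, par, ? or ?d node *)

Section Terminal.
Variables (S : {set nodes G}) (d : arcs G).
Hypothesis partS : part S.
Hypothesis dS : tail d \in S.
Hypothesis hd : head d \notin S.
Hypothesis c1 : #|conclusions (tail d)| = 1.

Let S0 := S :\ tail d.

Lemma part_remove : part S0.
Proof.
have [upS concS] := partS; split=> [x|x]; rewrite !in_setD1.
  case/andP=> nx hx; rewrite upS // andbT conclusion_eq //.
  by apply: contraL hx => /eqP->.
by case/andP=> _ /concS.
Qed.

Lemma boundary_remove x :
  (x \in boundary S0) = (x \in boundary S) && (x != d) || (head x == tail d).
Proof.
have [upS _] := partS.
rewrite !inE -(conclusion_eq x c1) negb_and negbK.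
have [hx|hx] := eqVneq (head x) (tail d).
  rewrite orbT andbT upS ?hx // andbT.
  by have := no_loop x; rewrite hx eq_sym => ->.
rewrite /= orbF andbC andbA [_ && (tail x \in S)]andbC -!andbA.
by congr (_ && _); rewrite andbC.
Qed.

Lemma boundary_insert x :
  (x \in boundary S) = (x \in enum (boundary S :\ d) ++ [:: d]).
Proof.
rewrite mem_cat mem_enum in_setD1 mem_seq1 orbC.
by case: eqVneq => [->|] //=; rewrite !inE dS hd.
Qed.

Lemma derivable_remove ps : derivable_part S0 ->
  uniq ps -> ps =i premises (tail d) -> num_outputs S0 = num_outputs S ->
  (derivable S0 (enum (boundary S :\ d) ++ ps) ->
   derivable (tail d |: S0) (enum (boundary S :\ d) ++ [:: d])) ->
  derivable_part S.
Proof.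
move=> seq0 Ups mem_ps eq_out rule _ outS c Uc memc.
apply: derivable_reorder Uc memc; last first.
- by move=> x; rewrite boundary_insert.
- by rewrite cats1 rcons_uniq enum_uniq mem_enum !inE eqxx.
have eqS : tail d |: S0 = S by apply: setD1K.
rewrite eqS in rule; apply/rule/seq0.
- exact: part_remove.
- by rewrite eq_out.
- rewrite cat_uniq enum_uniq Ups andbT /=; apply/hasPn=> x.
  rewrite mem_ps mem_enum !inE => /eqP->.
  by rewrite dS !andbF.
- move=> x; rewrite mem_cat mem_enum mem_ps boundary_remove !inE.
  by congr (_ || _); rewrite andbC.
Qed.

Lemma outputs_remove : negative (ty d) ->
  (forall x, head x = tail d -> negative (ty x)) -> lab (tail d) != Lder ->
  num_outputs S0 = num_outputs S.
Proof.
move=> Nd Np nder; rewrite /num_outputs; congr (_ + _).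
  apply: eq_card => x; rewrite !inE.
  by have [->|] := eqVneq x (tail d); rewrite ?(negPf nder) ?andbF.
apply: eq_card => x; rewrite in_set boundary_remove in_set.
have [->|nx] := eqVneq x d; first by rewrite output_ninput // Nd !andbF.
have [/Np Nx|] := eqVneq (head x) (tail d); last by rewrite orbF andbT.
by rewrite output_ninput // Nx !andbF.
Qed.

Lemma derivable_terminal :
  derivable_part S0 -> lab (tail d) \in [:: Lbot; Lpar; Lder; Lwhy] -> derivable_part S.
Proof.
move=> seq0 ln.
have Nd : negative (ty d).
  have := conclusion_polarity groundG polG typedG d.
  by case: (lab (tail d)) ln.
have nS0 : tail d \notin S0 by rewrite !inE eqxx.
have hd0 : head d \notin tail d |: S0 by rewrite setD1K.
have neg_prem x : lab (tail d) != Lder -> head x = tail d -> negative (ty x).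
  move=> nder hx; have := premise_polarity groundG polG typedG x.
  by rewrite hx; case: (lab (tail d)) ln nder.
move: ln; rewrite !inE => /or4P[] /eqP ln.
- apply: (@derivable_remove [::]) => //.
  + move=> x; have := arityG (tail d); rewrite ln => /andP[/eqP/cards0_eq-> _].
    by rewrite inE.
  + by apply: outputs_remove => // [x|]; [apply: neg_prem|]; rewrite ln.
  + by rewrite cats0; apply: rule_bot.
- have [Up mem_p] : enumerates (prems (tail d)) (premises (tail d)).
    by case: groundG => _ _ _; apply; rewrite ln.
  apply: (@derivable_remove (prems (tail d))) => //.
  + by apply: outputs_remove => // [x|]; [apply: neg_prem|]; rewrite ln.
  + exact: rule_par.
- have := arityG (tail d); rewrite ln => /andP[/eqP p1 _].
  have [a ha] : exists a, head a = tail d by apply: premise_of; rewrite p1.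
  have mem_a x : (x == a) = (head x == tail d).
    apply/eqP/eqP=> [->//|hx]; apply: premise_unique; rewrite ?hx //.
  have Pa : positive (ty a).
    by have := premise_polarity groundG polG typedG a; rewrite ha ln.
  apply: (@derivable_remove [:: a]) => //.
  + by move=> x; rewrite !inE mem_a.
  (* Both cardinals change by one, in opposite directions: the ?d node leaves the first set and its
     output premise [a] joins the second. *)
  + have der_d : tail d \in [set n in S | lab n == Lder] by rewrite inE dS ln eqxx.
    have bnd_a : a \in [set x in boundary S0 | positive (ty x)].
      by rewrite in_set boundary_remove ha eqxx orbT.
    rewrite /num_outputs (cardsD1 (tail d) [set n in S | _]) der_d.
    rewrite (cardsD1 a [set x in boundary S0 | _]) bnd_a.
    rewrite addnCA -addnA; congr (_ + (_ + _)); apply: eq_card => x.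
      by rewrite !inE andbA.
    rewrite in_setD1 in_set boundary_remove mem_a [in RHS]in_set.
    have [->|nx] := eqVneq x d; first by rewrite output_ninput // Nd !andbF.
    have [hx|_] := eqVneq (head x) (tail d); last by rewrite andbT orbF.
    by rewrite in_set hx dS andbF.
  + exact: rule_der.
- apply: (@derivable_remove (enum (premises (tail d)))) => //.
  + exact: enum_uniq.
  + by move=> x; rewrite mem_enum.
  + by apply: outputs_remove => // [x|]; [apply: neg_prem|]; rewrite ln.
  + exact: rule_why.
Qed.

End Terminal.

(** * Parts ending with a cut, a tensor, an axiom, a one or a box *)

Lemma simple_num_outputs (S : {set nodes G}) :
  (forall x, x \in S -> simple x) ->
  num_outputs S = #|[set a in boundary S | positive (ty a)]|.
Proof.
move=> simS; rewrite /num_outputs.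
have -> : [set n in S | lab n == Lder] = set0; last by rewrite cards0.
apply/setP=> x; rewrite !inE; apply/negbTE/negP=> /andP[/simS sx /eqP lx].
by move: sx; rewrite /simple lx.
Qed.

(** The invariant holds for the tree [T]: being made of simple nodes it has no ?d node, and [a] is
    the only output on its boundary. *)
Lemma derivable_tree (S T : {set nodes G}) (a : arcs G) :
  (forall x, (x \in boundary T) = (x == a) || (x \in boundary S) && (tail x \in T)) ->
  (forall x, x \in boundary S -> tail x \in T -> negative (ty x)) ->
  (forall x, x \in T -> simple x) -> positive (ty a) -> part T ->
  a \notin boundary S -> derivable_part T ->
  derivable T (enum [set x in boundary S | tail x \in T] ++ [:: a]).
Proof.
move=> bT negT simT Pa partT naS; apply=> //.
- rewrite simple_num_outputs //; apply/eqP/cards1P; exists a.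
  apply/setP=> x; rewrite in_set bT in_set1.
  have [->//|_] /= := eqVneq x a.
  by apply/negbTE/negP=> /andP[/andP[/negT/[apply]]]; rewrite output_ninput // => ->.
- by rewrite cats1 rcons_uniq enum_uniq mem_enum in_set (negPf naS).
- by move=> x; rewrite mem_cat mem_enum mem_seq1 orbC bT in_set.
Qed.

(** By duality exactly one premise of the cut is an output; the splitting is done there. The tree
    [T] takes away neither a ?d node nor a boundary output of [S], and the other premise is an
    input, so [U] has the same count as [S]. *)
Lemma derivable_at_cut (S : {set nodes G}) n :
  n \in S -> lab n = Lcut -> (forall x, x \in S -> r x < r n -> simple x) ->
  (forall S' : {set nodes G}, #|S'| < #|S| -> derivable_part S') -> derivable_part S.
Proof.
move=> nS ln sim_n IH partS outS c Uc memc.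
have := arityG n; rewrite ln => /andP[/eqP p2 /eqP/cards0_eq c0].
have no_concl (x : arcs G) : tail x <> n.
  by move=> tx; have := in_set0 x; rewrite -c0 inE tx eqxx.
have [a [b [ha hb ab Pa Nb]]] : exists a b : arcs G,
    [/\ head a = n, head b = n, a <> b, positive (ty a) & negative (ty b)].
  have /card_gt1P[a [b]] : 1 < #|premises n| by rewrite p2.
  rewrite !inE => -[/eqP ha /eqP hb /eqP ab].
  have := typedG n; rewrite /node_typed ln => typ.
  have := dual_polarity (ty a); rewrite -(typ a b) // => -[pb nb].
  case Na: (negative (ty a)); last first.
    by exists a, b; rewrite nb output_ninput // Na.
  by exists b, a; rewrite pb Na; split=> // /esym.
have prem_n x : head x = n -> x = a \/ x = b.
  move=> hx; have := set2_of_card p2 _ _ (introN eqP ab); rewrite !inE ha hb eqxx.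
  move=> /(_ isT isT)/setP/(_ x); rewrite !inE hx eqxx => /esym/orP[]/eqP;
    by [left|right].
have [T [U [[eqS nTU dis] [[partT partU outT outU] [bT bU negT simT]]]]] :=
  split_at_premise partS nS ha hb ab prem_n Pa
    (fun x tx => False_ind _ (no_concl x tx)) sim_n.
have prem_nb x : head x = n -> x \notin boundary S.
  by move=> hx; rewrite inE hx nS andbF.
have [ltT ltU] : #|T| < #|S| /\ #|U| < #|S|.
  rewrite eqS cardsU1 nTU cardsU disjoint_setI0 // cards0; lia.
have outsU : num_outputs U = 1.
  rewrite -outS; congr (_ + _); apply: eq_card => x.
    rewrite !inE eqS in_setU1 in_setU.
    have [->|_] := eqVneq x n; first by rewrite ln andbF.
    have [xT|//] := boolP (x \in T).
    by have := simT x xT; rewrite /simple /=; case: (lab x); rewrite ?andbF.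
  rewrite in_set bU [RHS]in_set.
  have [->|_] /= := eqVneq x b.
    by rewrite (negPf (prem_nb b hb)) output_ninput // Nb.
  have [xS|//] := boolP (x \in boundary S).
  have: tail x \in S by move: xS; rewrite inE => /andP[].
  rewrite eqS in_setU1 in_setU => /or3P[/eqP/no_concl//|xT|->//].
  by rewrite output_ninput // (negT x) // !andbF.
have seqT := derivable_tree bT negT simT Pa partT (prem_nb a ha) (IH T ltT).
pose cU := [set x in boundary S | tail x \in U].
have bnbU : b \notin cU by rewrite inE (negPf (prem_nb b hb)).
have seqU : derivable U (b :: enum cU).
  apply: IH => //.
    by rewrite cons_uniq enum_uniq mem_enum bnbU.
  by move=> x; rewrite inE mem_enum bU in_set.
have := rule_cut groundG polG typedG ln ha hb ab nTU dis outT outU seqT seqU.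
rewrite -eqS => seqS; apply: derivable_reorder seqS _ _ Uc memc.
  rewrite cat_uniq !enum_uniq andbT /=; apply/hasPn=> x.
  rewrite !mem_enum !inE => /andP[_ xU]; rewrite negb_and.
  by move/pred0P: dis => /(_ (tail x)) /=; rewrite xU andbT => ->; rewrite orbT.
move=> x; rewrite mem_cat !mem_enum /cU.
have inC (V : {set nodes G}) : (x \in [set y in boundary S | tail y \in V]) =
    (x \in boundary S) && (tail x \in V) by rewrite in_set.
rewrite !inC -andb_orr; have [xS|//] := boolP (x \in boundary S); rewrite /=.
have: tail x \in S by move: xS; rewrite inE => /andP[].
by rewrite eqS in_setU1 in_setU => /orP[/eqP/no_concl|].
Qed.

(** Both premises are outputs here, while the only output of [S], the conclusion [d] of the tensor,
    disappears. Each side is thus left with one output, its own premise. *)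
Lemma derivable_at_tens (S : {set nodes G}) (d : arcs G) :
  (forall x, x \in S -> simple x) -> d \in boundary S ->
  lab (tail d) = Ltens ->
  (forall S' : {set nodes G}, #|S'| < #|S| -> derivable_part S') -> derivable_part S.
Proof.
set n := tail d => simS bd ln IH partS outS c Uc memc.
have [nS hd] : n \in S /\ head d \notin S by move: bd; rewrite inE => /andP[].
have c1 : #|conclusions n| = 1 by apply: one_conclusion; rewrite ln.
have := arityG n; rewrite ln => /andP[/eqP p2 _].
have [Up mem_p] : enumerates (prems n) (premises n).
  by case: groundG => _ _ _; apply; rewrite ln.
have [a [b eq_p]] : exists a b, prems n = [:: a; b].
  have: size (prems n) = 2 by rewrite -p2 cardE; apply/perm_size/uniq_perm => //;
    [apply: enum_uniq|move=> x; rewrite mem_enum mem_p].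
  by case: (prems n) => [|a [|b [|? ?]]] // _; exists a, b.
have prem_n x : (head x == n) = (x == a) || (x == b).
  by have := mem_p x; rewrite eq_p !inE => ->.
have ab : a <> b by move: Up; rewrite eq_p /= inE andbT => /eqP.
have ha : head a = n by apply/eqP; rewrite prem_n eqxx.
have hb : head b = n by apply/eqP; rewrite prem_n eqxx orbT.
have pos_p x : head x = n -> positive (ty x).
  by move=> hx; apply: simple_premise; rewrite hx; apply: simS.
have concl_n x : tail x = n -> x = d.
  by move=> tx; apply/eqP; rewrite -conclusion_eq ?tx -/n ?eqxx.
have pos_d : positive (ty d).
  by have := conclusion_polarity groundG polG typedG d; rewrite -/n ln.
have out_d x : x \in boundary S -> positive (ty x) -> x = d.
  have /eqP/cards1P[e eq_e] : #|[set x in boundary S | positive (ty x)]| = 1.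
    by rewrite -simple_num_outputs.
  have in_e y : y \in boundary S -> positive (ty y) -> y = e.
    move=> yS Py; apply/set1P; rewrite -eq_e in_set yS.
    exact: Py.
  by move=> xS Px; rewrite (in_e x xS Px) (in_e d bd pos_d).
have [|x hx|x xS _|T [U [[eqS nTU dis] [[partT partU outT outU] [bT bU negT simT]]]]] :=
  @split_at_premise S n a b partS nS ha hb ab _ (pos_p a ha).
- by move=> x /eqP; rewrite prem_n => /orP[]/eqP; [left|right].
- by rewrite (concl_n x hx).
- exact: simS.
have prem_nb x : head x = n -> x \notin boundary S.
  by move=> hx; rewrite inE hx nS andbF.
have [ltT ltU] : #|T| < #|S| /\ #|U| < #|S|.
  rewrite eqS cardsU1 nTU cardsU disjoint_setI0 // cards0; lia.
have [nT nU] : n \notin T /\ n \notin U by apply/norP; rewrite -in_setU.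
have simU x : x \in U -> simple x.
  by move=> xU; apply: simS; rewrite eqS !inE xU !orbT.
have outsU : num_outputs U = 1.
  rewrite simple_num_outputs //; apply/eqP/cards1P; exists b; apply/setP=> x.
  rewrite in_set bU in_set1; have [->|_] /= := eqVneq x b; first exact: pos_p.
  apply/negbTE/negP=> /andP[/andP[xS xU] /(out_d x xS) eq_x].
  by move: nU; rewrite /n -eq_x xU.
have seqT := derivable_tree bT negT simT (pos_p a ha) partT (prem_nb a ha) (IH T ltT).
pose cT := [set x in boundary S | tail x \in T].
pose cU := [set x in boundary S | tail x \in U].
have inC (V : {set nodes G}) x : (x \in [set y in boundary S | tail y \in V]) =
    (x \in boundary S) && (tail x \in V) by rewrite in_set.
have seqU : derivable U (b :: enum cU).
  apply: IH => //.
    by rewrite cons_uniq enum_uniq mem_enum inC (negPf (prem_nb b hb)).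
  by move=> x; rewrite inE mem_enum bU inC.
have hd' : head d \notin n |: (T :|: U) by rewrite -eqS.
have := rule_tens groundG polG typedG ln eq_p (erefl n) nTU hd' dis outT outU seqT seqU.
rewrite -eqS => seqS; apply: derivable_reorder seqS _ _ Uc memc.
  rewrite cat_uniq cons_uniq !enum_uniq andbT /= !mem_enum !inC -/n.
  rewrite (negPf nT) (negPf nU) !andbF /= andbT; apply/hasPn=> x.
  rewrite !mem_enum !inC => /andP[_ xU]; rewrite negb_and.
  by move/pred0P: dis => /(_ (tail x)) /=; rewrite xU andbT => ->; rewrite orbT.
move=> x; rewrite mem_cat inE !mem_enum !inC.
have [->|nx] := eqVneq x d; first by rewrite bd orbT.
rewrite /= -andb_orr; have [xS|//] := boolP (x \in boundary S); rewrite /=.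
have: tail x \in S by move: xS; rewrite inE => /andP[].
rewrite eqS in_setU1 in_setU => /orP[/eqP/concl_n eq_x|//].
by rewrite eq_x eqxx in nx.
Qed.

(** The base case: a simple node other than a tensor has no premise, so no other node of [S] can
    send its output into [n], and [S] is reduced to one axiom, one or ! node. *)
Lemma derivable_leaf (S : {set nodes G}) (d : arcs G) :
  (forall x, x \in S -> simple x) -> d \in boundary S -> positive (ty d) ->
  lab (tail d) != Ltens -> derivable_part S.
Proof.
set n := tail d => simS bd Pd ln partS outS c Uc memc.
have [nS hd] : n \in S /\ head d \notin S by move: bd; rewrite inE => /andP[].
have out_d x : x \in boundary S -> positive (ty x) -> x = d.
  have /eqP/cards1P[e eq_e] : #|[set x in boundary S | positive (ty x)]| = 1.
    by rewrite -simple_num_outputs.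
  have in_e y : y \in boundary S -> positive (ty y) -> y = e.
    move=> yS Py; apply/set1P; rewrite -eq_e in_set yS.
    exact: Py.
  by move=> xS Px; rewrite (in_e x xS Px) (in_e d bd Pd).
have no_prem x : head x != n.
  apply/eqP=> hx; have := premise_polarity groundG polG typedG x.
  by have := simS n nS; rewrite hx /simple; case: (lab n) ln.
(* Following output conclusions upwards one leaves [S] through [d]. *)
have eqS : S = [set n].
  apply/eqP; rewrite eqEsubset sub1set nS andbT; apply/subsetP=> y0 y0S.
  rewrite inE; apply/contraT=> ny0.
  have y0D : y0 \in S :\ n by rewrite !inE ny0.
  have [y yD y_max] := @arg_maxnP _ y0 (fun y => y \in S :\ n) r y0D.
  have [yn yS] : y != n /\ y \in S by move: yD; rewrite !inE => /andP[].
  have [e ey] : exists e, io_src ty e = y.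
    have [e /eqP ey|no_out] := pickP (fun e => io_src ty e == y); first by exists e.
    have: y \in sinks ty.
      by apply/(sinkP groundG polG typedG bangG) => e; rewrite no_out.
    have := simS y yS; rewrite /simple !inE /is_weakening.
    by case: (lab y).
  have := r_lt e; move: ey; case: (io_srcP polG e) => [Ne|Pe] ey lt_e.
    by have := @simple_premise e; rewrite ey simS // output_ninput // Ne => /(_ isT).
  have [eS|eS] := boolP (head e \in S).
    have eD : head e \in S :\ n by rewrite !inE eS no_prem.
    by have : r (head e) <= r y := y_max _ eD; rewrite leqNgt -ey lt_e.
  have ed : e = d by apply: out_d => //; rewrite inE ey yS.
  by rewrite -ey ed eqxx in yn.
have mem_bnd x : (x \in boundary S) = (tail x == n).
  by rewrite inE eqS !in_set1 no_prem andbT.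
suff [c0 [seq0 U0 mem0]] : exists c0, [/\ derivable S c0, uniq c0 & c0 =i boundary S].
  exact: (derivable_reorder seq0).
have := simS n nS; rewrite /simple !inE (negPf ln) /= => /or3P[] /eqP lab_n.
- have := arityG n; rewrite lab_n => /andP[_ /eqP c2].
  have /card_gt1P[a [b]] : 1 < #|conclusions n| by rewrite c2.
  rewrite !inE => -[/eqP ta /eqP tb ab]; exists [:: a; b]; split.
  + by rewrite eqS; apply: rule_ax => //; apply/eqP.
  + by rewrite /= inE ab.
  + move=> x; rewrite mem_bnd.
    have := set2_of_card c2 _ _ ab; rewrite !inE ta tb eqxx.
    by move=> /(_ isT isT)/setP/(_ x); rewrite !inE.
- have c1 : #|conclusions n| = 1 by apply: one_conclusion; rewrite lab_n.
  exists [:: d]; split=> //; first by rewrite eqS; apply: rule_one.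
  by move=> x; rewrite mem_bnd inE conclusion_eq.
- have h0 : is_bang (lab n) by rewrite lab_n.
  have [As [A [tyn [pi pin boxE]]]] := boxes h0.
  have [Un mem_n] : enumerates (bang_concls n) (conclusions n).
    by case: groundG => _ _ + _; apply.
  exists (bang_concls n); split=> //; last by move=> x; rewrite mem_n mem_bnd inE.
  rewrite eqS; apply: rule_bang tyn pin _ => // h.
  by rewrite (bool_irrelevance h h0).
Qed.

Lemma derivable_all (S : {set nodes G}) : derivable_part S.
Proof.
have [m] := ubnP #|S|; elim: m S => // m IHm S lt_m.
have IH (S' : {set nodes G}) : #|S'| < #|S| -> derivable_part S'.
  by move=> lt_S'; apply: IHm; lia.
move=> partS outS.
have [d|inner] := pickP (fun d : arcs G =>
    (d \in boundary S) && (lab (tail d) \in [:: Lbot; Lpar; Lder; Lwhy])).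
  rewrite inE -andbA => /and3P[dS hd ln]; apply: (derivable_terminal partS dS hd) => //.
    by apply: one_conclusion; case: (lab _) ln.
  by apply: IH; rewrite [in X in _ < X](cardsD1 (tail d)) dS.
have {}inner (a : arcs G) : tail a \in S ->
    lab (tail a) \in [:: Lbot; Lpar; Lder; Lwhy] -> head a \in S.
  move=> aS la; apply/contraT=> haS.
  by have := inner a; rewrite inE aS haS la.
have [n /andP[nS /eqP ln]|no_cut] := pickP (fun n => (n \in S) && (lab n == Lcut)).
  have nC : [pred x in S | lab x == Lcut] n by rewrite /= nS ln eqxx.
  have [k /andP[kS /eqP lk] k_min] := @arg_minnP _ n [pred x in S | lab x == Lcut] r nC.
  apply: (derivable_at_cut kS lk) => //; apply: (simple_below partS inner) => x xS lx.
  by apply: k_min; rewrite /= xS lx eqxx.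
have simS x : x \in S -> simple x.
  (* In the absence of cuts the threshold is arbitrary; [(r x).+1] is chosen to include [x]
     itself. *)
  move=> xS; apply: (@simple_below S (r x).+1 partS inner) => // y yS ly.
  by have := no_cut y; rewrite yS ly eqxx.
have /eqP/cards1P[d eq_d] : #|[set x in boundary S | positive (ty x)]| = 1.
  by rewrite -simple_num_outputs.
have : d \in [set x in boundary S | positive (ty x)] by rewrite eq_d set11.
rewrite in_set => /andP[bd Pd].
have [ln|ln] := eqVneq (lab (tail d)) Ltens.
  exact: derivable_at_tens bd ln IH partS outS.
exact: derivable_leaf bd Pd ln partS outS.
Qed.

End Sequentialization.

(** * Correctness of desequentialized proofs *)

(** Written as a sum in order to split along the sum types of nodes in [union_graph] and
    [add_graph]. *)
Definition num_der (G : ground) : nat := \sum_(n : nodes G) (lab n == Lder).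

(** The i/o criterion in a form that follows the constructions of [deseq]: a rank replaces directed
    acyclicity, and output conclusions are counted on the sequent. *)
Definition good_ground (G : ground) (ty : arcs G -> formula) : Prop :=
  (exists r : nodes G -> nat, forall a, r (io_src ty a) < r (io_tgt ty a)) /\
  num_der G + count positive (map ty (concls G)) = 1.

Lemma at_every_depthE (P : forall G : ground, (arcs G -> formula) -> Prop) R :
  at_every_depth P R <-> P (ground_of R) (@type_of R) /\
    forall n h, at_every_depth P (@box_of R n h).
Proof. by case: R. Qed.

(** What makes [relocate] safe: a conclusion node has at most one premise and no conclusion, so
    deleting the heads of [s] redirects exactly the arcs of [s] and moves no tail. *)
Record well_formed (R : proof_structure) (Gamma : seq formula) : Prop :=
  WellFormed {
    wf_uniq : uniq (concls_of R);
    wf_concls : forall a, a \in concls_of R -> lab (head a) = Lconc;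
    wf_head_inj : forall a a' : arcs (ground_of R),
      lab (head a) = Lconc -> head a = head a' -> a = a';
    wf_tail : forall a : arcs (ground_of R), lab (tail a) != Lconc;
    wf_types : concl_types R = Gamma }.

Section AddNodeGood.
Variables (R : proof_structure) (Gamma : seq formula).
Variables (s : seq (arcs (ground_of R))) (l : label).
Variables (b : is_bang l -> proof_structure) (K : finType) (tyK : K -> formula).
Variable c : seq (arcs (ground_of R) + K).
Hypothesis wfR : well_formed R Gamma.
Hypothesis sub_s : {subset s <= concls_of R}.
Hypothesis l_nconc : l != Lconc.

Lemma relocate_head (a : arcs (ground_of R)) :
  (a \in s /\ relocate s K (head a) = inr None) \/
  (exists2 k : kept_node s, val k = head a & relocate s K (head a) = inl k).
Proof.
case: (relocateP s K (head a)) => [[/mapP[d ds hd] ->]|]; [left|by right].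
split=> //; rewrite -(wf_head_inj wfR (wf_concls wfR (sub_s ds)) (esym hd)).
by [].
Qed.

Lemma relocate_tail (a : arcs (ground_of R)) :
  exists2 k : kept_node s, val k = tail a & relocate s K (tail a) = inl k.
Proof.
case: (relocateP s K (tail a)) => // -[/mapP[d /sub_s/(wf_concls wfR) ld td] _].
by have := wf_tail wfR a; rewrite td ld.
Qed.

Lemma well_formed_add : uniq c ->
  (forall a, inl a \in c -> a \in concls_of R /\ a \notin s) ->
  well_formed (add_node s b tyK c)
    (map (fun a => match a with inl a => type_of a | inr k => tyK k end) c).
Proof.
move=> Uc in_c; split=> //.
- case=> a //= /in_c[ac ns].
  case: (relocate_head a) => [[as_ _]|[k vk ->]]; first by rewrite as_ in ns.
  by rewrite vk (wf_concls wfR).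
- case=> [a|k] [a'|k'] //=.
  + case: (relocate_head a) => [[_ ->] /= ll|[k vk ->] /= lk].
      by move: l_nconc; rewrite ll eqxx.
    case: (relocate_head a') => [[_ ->]|[k' vk' ->] [eq_k]] //.
    by congr inl; apply: (wf_head_inj wfR); [rewrite -vk|rewrite -vk -vk' eq_k].
  + by case: (relocate_head a) => [[_ ->]|[k vk ->]].
  + by case: (relocate_head a') => [[_ ->]|[k' vk ->]].
  + by move=> _ [->].
- case=> [a|k] //=; have [k vk ->] := relocate_tail a.
  by rewrite vk; apply: wf_tail wfR a.
Qed.

Lemma num_der_add : num_der (add_ground s l c) = num_der (ground_of R) + (l == Lder).
Proof.
rewrite /num_der big_sumType /=; congr (_ + _); last first.
  by rewrite (bigD1 None) //= big1 ?addn0 // => -[].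
rewrite -(big_sub [pred n | n \notin map (@head _) s] (fun n => lab n == Lder : nat)).
rewrite [RHS](bigID [pred n | n \notin map (@head _) s]) /=.
rewrite [X in _ = _ + X]big1 ?addn0 //.
move=> n; rewrite negbK => /mapP[a /sub_s/(wf_concls wfR) la ->].
by rewrite la.
Qed.

Lemma rank_add (r : nodes (ground_of R) -> nat) x :
  (forall a, r (io_src (@type_of R) a) < r (io_tgt (@type_of R) a)) ->
  {in s, forall a, if negative (type_of a) then x < r (tail a) else r (tail a) < x} ->
  exists r' : nodes (add_ground s l c) -> nat, forall a,
    r' (io_src (@type_of (add_node s b tyK c)) a) <
    r' (io_tgt (@type_of (add_node s b tyK c)) a).
Proof.
move=> r_lt r_s.
(* The threshold [x] separates the tails of output premises, below the new node, from those of input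
   premises, above it. Old ranks and [x] are shifted by one to leave 0 for the conclusion nodes of
   inputs, which are sources of their arcs. *)
exists (fun n => match n with
  | inl k => (r (val k)).+1
  | inr None => x.+1
  | inr (Some k) => if negative (tyK k) then 0 else x.+2 end).
case=> [a|k]; rewrite /io_src /io_tgt /=; last by case: ifP => ->.
have := r_lt a; rewrite /io_src /io_tgt; have [k vk ->] := relocate_tail a.
case: (relocate_head a) => [[/r_s as_ ->] _|[k' vk' ->]].
  by case: ifP as_; rewrite vk => _; rewrite ltnS.
by case: ifP; rewrite vk vk' ltnS.
Qed.

Lemma good_add : uniq c ->
  (forall a, inl a \in c -> a \in concls_of R /\ a \notin s) ->
  (forall n h, at_every_depth good_ground (@box_of R n h)) ->
  (forall h, at_every_depth good_ground (b h)) ->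
  (exists r x,
    (forall a, r (io_src (@type_of R) a) < r (io_tgt (@type_of R) a)) /\
    {in s, forall a, if negative (type_of a) then x < r (tail a) else r (tail a) < x}) ->
  forall Delta,
  map (fun a => match a with inl a => type_of a | inr k => tyK k end) c = Delta ->
  num_der (ground_of R) + (l == Lder) + count positive Delta = 1 ->
  well_formed (add_node s b tyK c) Delta /\
  at_every_depth good_ground (add_node s b tyK c).
Proof.
move=> Uc in_c boxR boxb [r [x [r_lt r_s]]] Delta <- num1.
split; first exact: well_formed_add.
split; last first.
  case=> [k|[k|]] h /=; [exact: boxR|by []|exact: boxb].
split; first exact: rank_add r_lt r_s.
by rewrite num_der_add.
Qed.

End AddNodeGood.

Lemma cat_inj_size (T : Type) (s1 s2 t1 t2 : seq T) :
  size s1 = size t1 -> s1 ++ s2 = t1 ++ t2 -> s1 = t1 /\ s2 = t2.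
Proof.
elim: s1 t1 => [|x s1 IHs] [|y t1] //= [/IHs eq_st] [-> /eq_st[-> ->]].
by [].
Qed.

Lemma rank_bounded (T : finType) (r : T -> nat) : exists m, forall n, r n < m.
Proof.
by exists (\max_n r n).+1 => n; rewrite ltnS; apply: (leq_bigmax n).
Qed.

Lemma proof_in_sequent F Gamma (pi : proof Gamma) : proof_in F pi -> all F Gamma.
Proof.
by case: pi => /=; intros; match goal with H : is_true (_ && _) |- _ =>
  case/andP: H end.
Qed.

Lemma good_unary R (Gamma ps : seq formula) l (b : is_bang l -> proof_structure) T k s :
  well_formed R (Gamma ++ ps) -> at_every_depth good_ground R ->
  concls_of R = k ++ s -> size k = size Gamma ->
  l != Lconc -> is_bang l = false ->
  all negative ps \/ all positive ps ->
  (l == Lder) + positive T = count positive ps ->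
  let R' := add_node s b (fun _ : unit => T) (map inl k ++ [:: inr tt]) in
  well_formed R' (Gamma ++ [:: T]) /\ at_every_depth good_ground R'.
Proof.
move=> wfR /at_every_depthE[[[r r_lt] num1] boxR] eqc szk lconc lbang pol_ps eqT R'.
have := wf_types wfR; rewrite /concl_types eqc map_cat.
move/(cat_inj_size _); rewrite size_map => /(_ szk)[tyk tys].
have := wf_uniq wfR; rewrite eqc cat_uniq => /and3P[Uk /hasPn ks Us].
apply: (good_add wfR) => //.
- by move=> a as_; rewrite eqc mem_cat as_ orbT.
- rewrite cat_uniq map_inj_uniq ?Uk //=; last by move=> ? ? [].
  by rewrite orbF andbT; apply/mapP=> -[].
- move=> a; rewrite mem_cat inE orbF mem_map => [ak|? ? [] //].
  rewrite eqc mem_cat ak; split=> //.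
  by apply/negP=> /ks; rewrite /= ak.
- by move=> h; exfalso; move: h; rewrite lbang.
- have pol_s (p : pred formula) : all p ps -> {in s, forall a, p (type_of a)}.
    by rewrite -tys all_map => /allP.
  have [m lt_m] := rank_bounded r.
  (* Input premises require a threshold below their tails: 0, once ranks are made positive. Output
     premises require one above: the bound [m]. *)
  case: pol_ps => /pol_s pol.
    exists (fun n => (r n).+1), 0; split=> // a as_.
    by rewrite (pol a as_).
  exists r, m; split=> // a as_.
  by rewrite not_polarized_both ?pol.
- by rewrite map_cat -map_comp /= -tyk.
- move: num1; rewrite -/(concls_of R) -/(concl_types R) (wf_types wfR) !count_cat /= addn0.
  lia.
Qed.

Lemma good_unary_drop R (Gamma ps : seq formula) l (b : is_bang l -> proof_structure) T :
  well_formed R (Gamma ++ ps) -> at_every_depth good_ground R ->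
  l != Lconc -> is_bang l = false ->
  all negative ps \/ all positive ps ->
  (l == Lder) + positive T = count positive ps ->
  let R' := add_node (drop (size Gamma) (concls_of R)) b (fun _ : unit => T)
      (map inl (take (size Gamma) (concls_of R)) ++ [:: inr tt]) in
  well_formed R' (Gamma ++ [:: T]) /\ at_every_depth good_ground R'.
Proof.
move=> wfR goodR lconc lbang pol_ps eqT.
apply: (good_unary _ wfR) => //; first by rewrite cat_take_drop.
have := wf_types wfR => /(congr1 size); rewrite size_map size_take size_cat => ->.
by case: ltnP; lia.
Qed.

Lemma permute_perm_eq (T : eqType) (c : seq T) sigma :
  perm_eq sigma (iota 0 (size c)) -> perm_eq (permute c sigma) c.
Proof.
move=> perm_s; have {2}-> : c = permute c (iota 0 (size c)).
  apply: (inj_map Some_inj); rewrite /permute pmapS_filter.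
  rewrite (all_filterP _); last first.
    by apply/allP=> i; rewrite mem_iota onthTE.
  by rewrite (eq_map (onthE c)) -[LHS](mkseq_nth None) /mkseq size_map.
exact: perm_pmap.
Qed.

Lemma good_exchange R Gamma sigma : perm_eq sigma (iota 0 (size Gamma)) ->
  well_formed R Gamma -> at_every_depth good_ground R ->
  well_formed (ps_exchange R sigma) (permute Gamma sigma) /\
  at_every_depth good_ground (ps_exchange R sigma).
Proof.
case: R => G ty box perm_s [Uc cc hi tc eqG] [[rk num1] boxR]; subst Gamma.
have perm_c : perm_eq (permute (concls G) sigma) (concls G).
  by apply: permute_perm_eq; move: perm_s; rewrite /concl_types size_map.
split; last first.
  split=> //; split=> //; rewrite /= -num1; congr (_ + _).
  by rewrite !count_map; apply/permP.
split=> //=.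
- by rewrite /concls_of /= (perm_uniq perm_c).
- by move=> a; rewrite (perm_mem perm_c); apply: cc.
- by rewrite /concl_types /= map_permute.
Qed.

Lemma wf_empty : well_formed ps_empty [::].
Proof. by split=> // -[]. Qed.

Lemma num_der_empty : num_der (ground_of ps_empty) = 0.
Proof. by apply: big1 => -[]. Qed.

Lemma good_initial l (b : is_bang l -> proof_structure) (K : finType)
    (tyK : K -> formula) (c : seq K) :
  l != Lconc -> uniq c -> (forall h, at_every_depth good_ground (b h)) ->
  (l == Lder) + count positive (map tyK c) = 1 ->
  let R := @add_node ps_empty [::] l b K tyK (map inr c) in
  well_formed R (map tyK c) /\ at_every_depth good_ground R.
Proof.
move=> lconc Uc goodb num1; apply: (good_add wf_empty) => //.
- by rewrite map_inj_uniq // => ? ? [].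
- by move=> n; case: (n : void).
- by exists (fun=> 0), 0; split=> a; case: (a : void).
- by rewrite -map_comp.
- by rewrite num_der_empty.
Qed.

Section Union.
Variables (R1 R2 : proof_structure) (Gamma1 Gamma2 : seq formula).
Hypothesis wf1 : well_formed R1 Gamma1.
Hypothesis wf2 : well_formed R2 Gamma2.

Lemma well_formed_union : well_formed (ps_union R1 R2) (Gamma1 ++ Gamma2).
Proof.
split.
- rewrite /concls_of /= cat_uniq !map_inj_uniq; try by move=> ? ? [].
  rewrite (wf_uniq wf1) (wf_uniq wf2) andbT /=; apply/hasPn=> _ /mapP[a _ ->].
  by apply/mapP=> -[].
- move=> a; rewrite mem_cat => /orP[] /mapP[a' c_a ->].
    exact: (wf_concls wf1 c_a).
  exact: (wf_concls wf2 c_a).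
- case=> a [] a' //= la [eq_h].
    by congr inl; apply: (wf_head_inj wf1).
  by congr inr; apply: (wf_head_inj wf2).
- by case=> a; [apply: (wf_tail wf1 a)|apply: (wf_tail wf2 a)].
- by rewrite /concl_types /concls_of /= map_cat -!map_comp -(wf_types wf1) -(wf_types wf2).
Qed.

Lemma num_der_union :
  num_der (ground_of (ps_union R1 R2)) = num_der (ground_of R1) + num_der (ground_of R2).
Proof. exact: big_sumType. Qed.

(* The ranks of one of the two structures are shifted above those of the other,
   leaving room for a node in between. *)
Lemma rank_union (low1 : bool) :
  (exists r : nodes (ground_of R1) -> nat, forall a,
     r (io_src (@type_of R1) a) < r (io_tgt (@type_of R1) a)) ->
  (exists r : nodes (ground_of R2) -> nat, forall a,
     r (io_src (@type_of R2) a) < r (io_tgt (@type_of R2) a)) ->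
  exists (r : nodes (ground_of (ps_union R1 R2)) -> nat) x,
    [/\ forall a, r (io_src (@type_of (ps_union R1 R2)) a) <
                 r (io_tgt (@type_of (ps_union R1 R2)) a),
        forall n, if low1 then r (inl n) < x else x < r (inl n)
      & forall n, if low1 then x < r (inr n) else r (inr n) < x].
Proof.
move=> [r1 lt1] [r2 lt2]; have [m1 b1] := rank_bounded r1.
have [m2 b2] := rank_bounded r2.
exists (fun n => match n with
  | inl n => r1 n + (if low1 then 0 else m2.+1)
  | inr n => r2 n + (if low1 then m1.+1 else 0) end).
exists (if low1 then m1 else m2).
split.
- case=> a; rewrite /io_src /io_tgt /=.
    by have := lt1 a; rewrite /io_src /io_tgt; case: ifP; rewrite ltn_add2r.
  by have := lt2 a; rewrite /io_src /io_tgt; case: ifP; rewrite ltn_add2r.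
- by move=> n; have := b1 n; case: low1; lia.
- by move=> n; have := b2 n; case: low1; lia.
Qed.

Lemma good_boxes_union :
  at_every_depth good_ground R1 -> at_every_depth good_ground R2 ->
  forall n h, at_every_depth good_ground (@box_of (ps_union R1 R2) n h).
Proof.
move=> /at_every_depthE[_ box1] /at_every_depthE[_ box2] [] n h.
  exact: box1.
exact: box2.
Qed.

End Union.

(** Cut and tensor at once. The equation on [cK] says that the two outputs of the premise structures
    merge into one: a cut consumes one output, a tensor consumes two and creates one. *)
Lemma good_binary R1 R2 Gamma1 Gamma2 A B l (b : is_bang l -> proof_structure)
    (K : finType) (tyK : K -> formula) (cK : seq K) :
  well_formed R1 (Gamma1 ++ [:: A]) -> well_formed R2 (B :: Gamma2) ->
  at_every_depth good_ground R1 -> at_every_depth good_ground R2 ->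
  l != Lconc -> l != Lder -> is_bang l = false -> uniq cK ->
  MELLpol A -> MELLpol B ->
  count positive (map tyK cK) + 1 = positive A + positive B ->
  let c1 := [seq inl a | a <- concls_of R1] in
  let c2 := [seq inr a | a <- concls_of R2] in
  let g := size Gamma1 in
  let R := @add_node (ps_union R1 R2) (drop g c1 ++ take 1 c2) l b K tyK
    (map inl (take g c1) ++ map inr cK ++ map inl (drop 1 c2)) in
  well_formed R (Gamma1 ++ map tyK cK ++ Gamma2) /\ at_every_depth good_ground R.
Proof.
move=> wf1 wf2 good1 good2 lconc lder lbang UcK polA polB numK c1 c2 g R.
have wfU := well_formed_union wf1 wf2.
have Uc : uniq (c1 ++ c2) := wf_uniq wfU.
have [k1 [e1 [eq1 tyk1 tye1]]] : exists k1 e1,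
    [/\ concls_of R1 = rcons k1 e1, map (@type_of R1) k1 = Gamma1 & type_of e1 = A].
  have := wf_types wf1; rewrite /concl_types; case/lastP: (concls_of R1) => [|k e].
    by case: (Gamma1).
  by rewrite map_rcons cats1 => /rcons_inj[<- <-]; exists k, e.
have [e2 [k2 [eq2 tye2 tyk2]]] : exists e2 k2,
    [/\ concls_of R2 = e2 :: k2, type_of e2 = B & map (@type_of R2) k2 = Gamma2].
  have := wf_types wf2; rewrite /concl_types; case: (concls_of R2) => [//|e k] /= [<- <-].
  by exists e, k.
have [/andP[Ne1 Uk1] /andP[Ne2 Uk2]] :
    (e1 \notin k1) && uniq k1 /\ (e2 \notin k2) && uniq k2.
  split; first by rewrite -rcons_uniq -eq1 (wf_uniq wf1).
  by rewrite -cons_uniq -eq2 (wf_uniq wf2).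
have g1 : g = size (map (@inl _ (arcs (ground_of R2))) k1) by rewrite /g -tyk1 !size_map.
have c1E : c1 = map inl k1 ++ [:: inl e1] by rewrite /c1 eq1 map_rcons cats1.
have c2E : c2 = inr e2 :: map inr k2 by rewrite /c2 eq2.
have take1 : take g c1 = map inl k1 by rewrite c1E g1 take_size_cat.
have drop1 : drop g c1 ++ take 1 c2 = [:: inl e1; inr e2].
  by rewrite c1E g1 drop_size_cat //= c2E /= take0.
have drop2 : drop 1 c2 = map inr k2 by rewrite c2E /= drop0.
have rank_s : exists r x,
    (forall a, r (io_src (@type_of (ps_union R1 R2)) a) <
               r (io_tgt (@type_of (ps_union R1 R2)) a)) /\
    {in drop g c1 ++ take 1 c2, forall a,
      if negative (@type_of (ps_union R1 R2) a) then x < r (tail a) else r (tail a) < x}.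
  have [[rk1 _] _] := (at_every_depthE _ _).1 good1.
  have [[rk2 _] _] := (at_every_depthE _ _).1 good2.
  have [r [x [r_lt low high]]] := rank_union (positive A) rk1 rk2.
  have [m lt_m] := rank_bounded r; rewrite drop1.
  (* If both premises are outputs, the new node is placed above everything. Otherwise exactly one
     is, and its structure was ranked below [x], the other one above; two inputs are excluded by
     [numK]. *)
  exists r, (if positive A && positive B then m else x); split=> // a.
  have nA := negative_npos polA; have nB := negative_npos polB.
  move: numK low high nA nB; case: (positive A); case: (positive B);
    move=> /= numK low high nA nB;
    rewrite !inE => /orP[] /eqP->; rewrite /= ?tye1 ?tye2 ?nA ?nB //.
  by clear -numK; lia.
have [[_ num1] _] := (at_every_depthE _ _).1 good1.
have [[_ num2] _] := (at_every_depthE _ _).1 good2.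
apply: (good_add wfU _ lconc _ _ (good_boxes_union good1 good2) _ rank_s).
- move=> a; rewrite drop1 !inE => /orP[]/eqP->.
    by rewrite mem_cat -/c1 c1E mem_cat mem_seq1 eqxx orbT.
  by rewrite mem_cat -/c2 c2E mem_head orbT.
- rewrite take1 drop2 cat_uniq cat_uniq.
  repeat rewrite map_inj_uniq; try by move=> ? ? [].
  rewrite Uk1 UcK Uk2 /= andbT; apply/andP; split; apply/hasPn=> x.
    rewrite mem_cat => /orP[] /mapP[y yk ->]; apply/mapP=> -[_ /mapP[w _ ->]] //.
    by case=> eq_y; rewrite eq_y in yk; case/mapP: yk.
  by case/mapP=> y _ ->; apply/mapP=> -[].
- move=> a; rewrite drop1 take1 drop2 => ac.
  have {ac}[[w wk ->]|[w wk ->]] : (exists2 w, w \in k1 & a = inl w) \/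
      (exists2 w, w \in k2 & a = inr w).
    move: ac; rewrite !mem_cat.
    case/or3P=> [/mapP[_ /mapP[w wk ->] [->]]|/mapP[//]|/mapP[_ /mapP[w wk ->] [->]]].
      by left; exists w.
    by right; exists w.
  + rewrite mem_cat -/c1 c1E mem_cat map_f //; split=> //.
    by rewrite !inE orbF; apply: contra Ne1 => /eqP[<-].
  + rewrite mem_cat -/c2 c2E inE map_f ?orbT //; split=> //.
    by rewrite !inE; apply: contra Ne2 => /eqP[<-].
- by move=> h; exfalso; move: h; rewrite lbang.
- by rewrite take1 drop2 !map_cat -!map_comp -tyk1 -tyk2.
- rewrite num_der_union (negPf lder) addn0 !count_cat.
  move: num1 num2; rewrite -/(concls_of R1) -/(concl_types R1).
  rewrite -/(concls_of R2) -/(concl_types R2).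
  rewrite (wf_types wf1) (wf_types wf2) count_cat /= addn0; lia.
Qed.

Lemma negative_not_positive A : negative A -> positive A = false.
Proof. by case: A. Qed.

Lemma count_whynot Gamma : count positive (map WhyNot Gamma) = 0.
Proof. by elim: Gamma. Qed.

Lemma deseq_good Gamma (pi : proof Gamma) : proof_in MELLpol pi ->
  well_formed (deseq pi) Gamma /\ at_every_depth good_ground (deseq pi).
Proof.
elim: pi => {Gamma}.
- move=> A /= /andP[/and3P[polA _ _] _].
  apply: (@good_initial _ _ bool (fun k => if k then A else dual A)
    [:: true; false]) => //=.
  by rewrite dual_polarity negative_npos //; case: positive.
- move=> Gamma Delta A pi1 IH1 pi2 IH2 /= /and3P[_ in1 in2].
  have [wf1 good1] := IH1 in1; have [wf2 good2] := IH2 in2.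
  have polA : MELLpol A.
    by have := proof_in_sequent in1; rewrite all_cat /= => /and3P[].
  have polA' : MELLpol (dual A) by have := proof_in_sequent in2 => /= /andP[].
  have := @good_binary _ _ _ _ A (dual A) Lcut nobox void
    (fun k => match k with end) [::] wf1 wf2 good1 good2.
  rewrite /= -map_cat; apply=> //.
  by rewrite dual_polarity negative_npos //; case: positive.
- move=> _; exact: (@good_initial Lone nobox unit (fun=> One) [:: tt]).
- move=> Gamma pi1 IH1 /= /andP[_ in1]; have [wf1 good1] := IH1 in1.
  apply: (@good_unary _ Gamma [::] Lbot nobox Bot) => //; rewrite ?cats0 //.
    by have := congr1 size (wf_types wf1); rewrite size_map.
  by left.
- move=> Gamma Delta A B pi1 IH1 pi2 IH2 /= /and3P[polT in1 in2].
  have [wf1 good1] := IH1 in1; have [wf2 good2] := IH2 in2.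
  have [polA polB] : MELLpol A /\ MELLpol B.
    have := proof_in_sequent in1; rewrite all_cat /= => /and3P[_ -> _].
    by have := proof_in_sequent in2 => /= /andP[].
  apply: (@good_binary _ _ _ _ A B Ltens nobox unit (fun=> Tens A B) [:: tt]
    wf1 wf2 good1 good2) => //=.
  move: polT; rewrite all_cat /= => /and3P[_ + _]; rewrite /MELLpol /=.
  by case/andP=> -> ->.
- move=> Gamma A B pi1 IH1 /= /andP[polT in1]; have [wf1 good1] := IH1 in1.
  move: polT; rewrite all_cat /= andbT {2}/MELLpol /= orbF => /and3P[_ nA nB].
  apply: good_unary_drop wf1 good1 _ _ _ _ => //; first by left; rewrite /= nA nB.
  by rewrite /= !negative_not_positive.
- move=> Gamma A pi1 IH1 /= /andP[polT in1]; have [wf1 good1] := IH1 in1.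
  set t := in_tuple _.
  have map_t : map (tnth t) (enum 'I_(size t)) = map WhyNot Gamma ++ [:: OfCourse A].
    exact: map_tnth_enum.
  have := @good_initial Lbang (fun=> deseq pi1) _ (tnth t) (enum 'I_(size t)).
  rewrite map_t; apply=> //; first exact: enum_uniq.
  move: polT; rewrite count_cat count_whynot all_cat /= andbT {2}/MELLpol /=.
  by case/andP=> _ ->.
- move=> Gamma A pi1 IH1 /= /andP[polT in1]; have [wf1 good1] := IH1 in1.
  move: polT; rewrite all_cat /= andbT {2}/MELLpol /= orbF => /andP[_ pA].
  by apply: good_unary_drop wf1 good1 _ _ _ _ => //; [right; rewrite /= pA|rewrite /= pA].
- move=> Gamma A k pi1 IH1 /= /andP[polT in1]; have [wf1 good1] := IH1 in1.
  move: polT; rewrite all_cat /= andbT {2}/MELLpol /= orbF => /andP[_ pA].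
  apply: good_unary_drop wf1 good1 _ _ _ _ => //.
    by left; rewrite all_nseq /= pA orbT.
  by rewrite count_nseq.
- move=> Gamma sigma perm_s pi1 IH1 /= /andP[_ in1]; have [wf1 good1] := IH1 in1.
  exact: good_exchange.
Qed.

(** * Assembling the equivalences over all depths *)

Lemma proof_structure_ground (G : ground) (ty : arcs G -> formula) box :
  proof_structure_of MELLpol (@PS G ty box) ->
  [/\ is_ground_structure G, forall a, MELLpol (ty a), forall n, node_typed ty n
    & bang_typed ty].
Proof.
case=> -[groundG _] [polG typedG boxes]; split=> // n ln.
have h : is_bang (lab n) by rewrite ln.
by have [[As [A [tyn _]]] _] := boxes n h; exists As, A.
Qed.

Lemma proof_structure_box (G : ground) (ty : arcs G -> formula) box n
    (h : is_bang (lab n)) :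
  proof_structure_of MELLpol (@PS G ty box) -> proof_structure_of MELLpol (box n h).
Proof.
by case=> -[_ psbox] [_ _ tybox]; split; [case: (psbox n h)|case: (tybox n h)].
Qed.

Section Outputs.
Variables (G : ground) (ty : arcs G -> formula).
Hypothesis groundG : is_ground_structure G.
Hypothesis polG : forall a, MELLpol (ty a).
Hypothesis typedG : forall n, node_typed ty n.

Let arityG (n : nodes G) : arity (lab n) #|premises n| #|conclusions n|.
Proof. by case: groundG. Qed.

Lemma d_c_der : d_c ty = [set n | lab n == Lder].
Proof.
apply/setP=> n; rewrite !inE; case: eqP => //= ln.
have := arityG n; rewrite ln => /andP[/eqP p1 _].
have [a ha] : exists a, head a = n by apply: premise_of; rewrite p1.
apply/existsP; exists a; rewrite inE ha eqxx.
by have := premise_polarity groundG polG typedG a; rewrite ha ln.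
Qed.

Lemma card_o_nodes :
  #|o_nodes ty| = #|[set a | (lab (head a) == Lconc) && positive (ty a)]|.
Proof.
have <- : @head G @: [set a | (lab (head a) == Lconc) && positive (ty a)] = o_nodes ty.
  apply/setP=> n; rewrite inE; apply/imsetP/andP => [[a]|[ln /existsP[a]]].
    rewrite inE => /andP[la Pa] ->; split=> //.
    by apply/existsP; exists a; rewrite inE eqxx.
  rewrite inE => /andP[/eqP ha Pa]; exists a => //.
  by rewrite inE ha ln.
apply: card_in_imset => a b; rewrite inE => /andP[/eqP la _] _.
by apply: premise_unique; have := arityG (head a); rewrite la => /andP[/eqP].
Qed.

Lemma count_concls (p : pred formula) :
  count p (map ty (concls G)) = #|[set a | (lab (head a) == Lconc) && p (ty a)]|.
Proof.
have [_ [Uc memc] _ _] := groundG.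
rewrite count_map -size_filter -(card_uniqP _) ?filter_uniq //.
by apply: eq_card => a; rewrite mem_filter memc !inE andbC.
Qed.

Lemma num_outputs_io :
  #|d_c ty| + #|o_nodes ty| = num_der G + count positive (map ty (concls G)).
Proof.
rewrite d_c_der card_o_nodes count_concls; congr (_ + _).
by rewrite /num_der -sum1dep_card big_mkcond.
Qed.

Lemma part_full : part [set n : nodes G | lab n != Lconc].
Proof.
split=> [a _|n]; rewrite inE //.
have := conclusion_polarity groundG polG typedG a.
by case: (lab (tail a)).
Qed.

Lemma boundary_full : boundary [set n : nodes G | lab n != Lconc] =
  [set a | lab (head a) == Lconc].
Proof.
apply/setP=> a; rewrite !inE negbK.
have := conclusion_polarity groundG polG typedG a.
by case: (lab (tail a)).
Qed.

Lemma num_outputs_full :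
  num_outputs ty [set n : nodes G | lab n != Lconc] = #|d_c ty| + #|o_nodes ty|.
Proof.
rewrite /num_outputs boundary_full d_c_der card_o_nodes; congr (_ + _).
  by apply: eq_card => n; rewrite !inE; case: (lab n).
by apply: eq_card => n; rewrite !inE.
Qed.

End Outputs.

(** Stronger than [sequentializable]: the sequent is exactly [concl_types R], so that the induction
    hypothesis on a box gives the premise expected by [p_bang]. *)
Lemma sequentialize R : proof_structure_of MELLpol R -> ACC_io R ->
  exists2 pi : proof (concl_types R), proof_in MELLpol pi & ps_equal R (deseq pi).
Proof.
elim: R => G ty box IHbox psR [[acyc out1] accbox].
have [groundG polG typedG bangG] := proof_structure_ground psR.
have /(io_directed_acyclicP groundG polG typedG)[r r_lt] := acyc.
have boxes n (h : is_bang (lab n)) : exists As A,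
    [seq ty a | a <- bang_concls n] = map WhyNot As ++ [:: OfCourse A] /\
    exists2 pi : proof (map WhyNot As ++ [:: A]),
      proof_in MELLpol pi & ps_equal (box n h) (deseq pi).
  have [_ [_ _ tybox]] := psR; have [[As [A [tyn tyb]]] _] := tybox n h.
  exists As, A; split=> //; rewrite -tyb.
  exact: IHbox (proof_structure_box h psR) (accbox n h).
have [_ [Uc memc] _ _] := groundG.
have [Gamma [pi [pin eqG rep]]] : derivable ty box [set n | lab n != Lconc] (concls G).
  apply: (derivable_all groundG polG typedG bangG r_lt boxes) => //.
  - exact: part_full groundG polG typedG.
  - by rewrite num_outputs_full.
  - by move=> a; rewrite (boundary_full groundG polG typedG) memc.
subst Gamma; exists pi => //.
exact: represents_full.
Qed.

(** A renaming preserves types, hence the orientation: the rank of [R'] is pulled back along [f],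
    and the count is transported by reindexing. *)
Lemma ACC_io_of_good R R' : proof_structure_of MELLpol R -> ps_equal R R' ->
  at_every_depth good_ground R' -> ACC_io R.
Proof.
elim: R R' => G ty box IHbox [G' ty' box'] psR.
case=> f [g [[[bij_f bij_g] [tail_g head_g] lab_f concls_g _] ty_g box_f]].
case=> -[[r r_lt] num1] good_box.
have [groundG polG typedG bangG] := proof_structure_ground psR.
split; last first.
  move=> n h; have h' : is_bang (lab (f n)) by rewrite lab_f.
  exact: IHbox (proof_structure_box h psR) (box_f n h h') (good_box _ h').
split.
  apply/(io_directed_acyclicP groundG polG typedG); exists (fun n => r (f n)) => a.
  have := r_lt (g a); rewrite /io_src /io_tgt ty_g tail_g head_g.
  by case: ifP.
rewrite num_outputs_io // -num1; congr (_ + _).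
  rewrite /num_der [RHS](reindex f) /=; last exact: onW_bij.
  by apply: eq_bigr => n _; rewrite lab_f.
by rewrite concls_g -map_comp !count_map; apply: eq_count => a /=; rewrite ty_g.
Qed.

Lemma ACC_w_io R : proof_structure_of MELLpol R -> (ACC_w R <-> ACC_io R).
Proof.
elim: R => G ty box IHbox psR.
have [groundG polG typedG bangG] := proof_structure_ground psR.
have ground_w_io := ground_ACC_w_io groundG polG typedG bangG.
split=> -[/ground_w_io accG accbox]; split=> // n h;
  exact/(IHbox n h (proof_structure_box h psR))/accbox.
Qed.

Theorem corollary29 (R : proof_structure) (hR : proof_structure_of MELLpol R) :
  (ACC_w R <-> ACC_io R) /\ (ACC_io R <-> sequentializable MELLpol R).
Proof.
split; first exact: ACC_w_io.
split=> [/(sequentialize hR)[pi pin eqR]|[Gamma [pi [pin eqR]]]].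
  by exists (concl_types R), pi.
by have [_] := deseq_good pin; apply: ACC_io_of_good hR eqR.
Qed.
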